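(* Let $\rho$ be an $n$-qubit (mixed) state and fix a bipartition $A|B$ of the qubits and an integer $r\ge1$. Suppose it is promised that either (a) $\mathcal{F}_r^O(\rho)\ge\epsilon_1$, or (b) $\mathcal{F}_r^O(\rho)\le\epsilon_2$, across the given bipartition, where it is assumed that $\mathrm{tr}(\rho^2)=1/\mathrm{poly}(n)$ and $(\epsilon_1^2/r-\epsilon_2)\,\mathrm{tr}(\rho^2)^2>1/\mathrm{poly}(n)$. Then there exists an efficient quantum algorithm to distinguish case (a) from case (b) using $O(r^2)$ copies of $\rho$ with high probability.
   Context: For a nonzero operator $O$ on $n$ qubits, its operator Schmidt decomposition across $A|B$ is $\frac{O}{\sqrt{\mathrm{tr}(O^\dagger O)}}=\sum_{i}\sqrt{\lambda_i^O}\,O_{A,i}\otimes O_{B,i}$, with $\lambda_i^O\ge0$, $\sum_i\lambda_i^O=1$, and $\{O_{A,i}\}$, $\{O_{B,i}\}$ orthonormal (in the Hilbert–Schmidt inner product) sets of operators on $A$ and $B$; the operator Schmidt rank is the number of nonzero $\lambda_i^O$. $|O\rangle$ denotes the vectorization of the normalized operator $O/\sqrt{\mathrm{tr}(O^\dagger O)}$, and $M_r^O$ is the set of $|O\rangle$ with operator Schmidt rank at most $r$. Define $\mathcal{F}_r^O(\rho)=\max_{|O\rangle\in M_r^O}|\langle O|\rho\rangle|^2=\max_{O}\frac{|\mathrm{tr}(O^\dagger\rho)|^2}{\mathrm{tr}(\rho^2)\,\mathrm{tr}(O^\dagger O)}$, where $|\rho\rangle$ is the vectorization of $\rho/\sqrt{\mathrm{tr}(\rho^2)}$.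 ''Efficient'' means running in time polynomial in $n$.
   Formalization: O(r^2) with an absolute constant is false (r=1, pure states, ε1=1, ε2=1−1/n need Ω(n) copies); the bound proved is C·r^2·(p(n)^2/(ε1^2−rε2))^2 for tr(ρ^2)≥1/p(n), C depending only on the error probability; ε1, ε2 are taken in [0,1]. *)

(* Defs.v *)
From mathcomp Require Import all_boot all_order all_algebra.
From mathcomp Require Import spectral sesquilinear complex.
From mathcomp Require Import boolp classical_sets reals.

Set Implicit Arguments.
Unset Strict Implicit.
Unset Printing Implicit Defensive.

Import Order.TTheory GRing.Theory Num.Theory.

Local Open Scope ring_scope.
Local Open Scope sesquilinear_scope.

(** ** Operators on qubits labelled by a finite type *)

Definition bits (T : finType) : finType := {ffun T -> bool}.

(* Rows and columns are numbered by the library's enumeration of [bits T];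
   [opmx] and [entry] translate to and from computational-basis labels. *)
Notation operator R T := 'M[(R : rcfType)[i]]_(#|{: bits T}|).

Definition opmx (R : rcfType) (T : finType) (f : bits T -> bits T -> R[i]) :
    operator R T :=
  \matrix_(a, b) f (enum_val a) (enum_val b).

Definition entry (R : rcfType) (T : finType) (M : operator R T)
    (x y : bits T) : R[i] :=
  M (enum_rank x) (enum_rank y).

Definition is_state (R : rcfType) (T : finType) (rho : operator R T) : Prop :=
  [/\ rho \is hermsymmx,
      forall u : 'rV[R[i]]_(#|{: bits T}|), 0 <= (u *m rho *m u^t*) 0 0
    & \tr rho = 1].

Definition purity (R : rcfType) (T : finType) (rho : operator R T) : R :=
  complex.Re (\tr (rho *m rho)).

(** ** Operator Schmidt decomposition across [A | ~: A] *)

Definition side (n : nat) (A : {set 'I_n}) : finType := {i : 'I_n | i \in A}.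

Definition restrict_bits (n : nat) (A : {set 'I_n}) (x : bits 'I_n) :
    bits (side A) :=
  [ffun i => x (val i)].

Definition optensor (R : rcfType) (n : nat) (A : {set 'I_n})
    (OA : operator R (side A)) (OB : operator R (side (~: A))) :
    operator R 'I_n :=
  opmx (fun x y => entry OA (restrict_bits A x) (restrict_bits A y)
                   * entry OB (restrict_bits (~: A) x) (restrict_bits (~: A) y)).

Definition hs_orthonormal (R : rcfType) (T I : finType)
    (F : I -> operator R T) : Prop :=
  forall i j, \tr ((F i)^t* *m F j) = (i == j)%:R.

Definition op_schmidt_decomposition (R : rcfType) (n : nat) (A : {set 'I_n})
    (O : operator R 'I_n) (m : nat) (lambda : 'I_m -> R)
    (OA : 'I_m -> operator R (side A))
    (OB : 'I_m -> operator R (side (~: A))) : Prop :=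
  [/\ forall i, 0 <= lambda i,
      \sum_i lambda i = 1,
      hs_orthonormal OA,
      hs_orthonormal OB
    & (sqrtC (\tr (O^t* *m O)))^-1 *: O
      = \sum_i (Num.sqrt (lambda i))%:C%C *: optensor (OA i) (OB i)].

(* The number of nonzero coefficients is the same in all decompositions of [O],
   so it does not matter that the decomposition is existentially quantified. *)
Definition op_schmidt_rank_le (R : rcfType) (n : nat) (A : {set 'I_n})
    (O : operator R 'I_n) (r : nat) : Prop :=
  exists (m : nat) (lambda : 'I_m -> R) (OA : 'I_m -> operator R (side A))
         (OB : 'I_m -> operator R (side (~: A))),
    op_schmidt_decomposition O lambda OA OB
    /\ (#|[set i | lambda i != 0%R]| <= r)%N.

Definition overlap (R : rcfType) (T : finType) (O rho : operator R T) : R :=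
  complex.Re (`|\tr (O^t* *m rho)| ^+ 2
              / (\tr (rho *m rho) * \tr (O^t* *m O))).

(* The supremum is a maximum: [overlap] is scale invariant and the normalized
   operators of rank at most [r] form a compact set. *)
Definition max_overlap (R : realType) (n : nat) (A : {set 'I_n}) (r : nat)
    (rho : operator R 'I_n) : R :=
  sup [set f | exists O : operator R 'I_n,
         [/\ O != 0, op_schmidt_rank_le A O r & f = overlap O rho]].

(** ** Quantum circuits *)

(* Wires are natural numbers.  A gate on a wire that does not exist, and a
   CNOT whose control and target coincide, act as the identity. *)
Inductive gate : Type :=
| GateH of nat
| GateT of nat
| GateCNOT of nat & nat.

Definition wire (w : nat) (x : bits 'I_w) (m : nat) : bool :=
  if insub m is Some i then x i else false.

Definition flip (w : nat) (t : nat) (b : bool) (x : bits 'I_w) : bits 'I_w :=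
  [ffun j : 'I_w => if val j == t then x j (+) b else x j].

Definition agree_off (w : nat) (i : nat) (x y : bits 'I_w) : bool :=
  [forall j : 'I_w, (val j != i) ==> (x j == y j)].

Definition gate_mx (R : rcfType) (w : nat) (g : gate) : operator R 'I_w :=
  match g with
  | GateH i =>
      if (i < w)%N then
        opmx (fun x y => if agree_off i x y
                         then (-1) ^+ (wire x i && wire y i) / sqrtC 2
                         else 0)
      else 1%:M
  | GateT i =>
      opmx (fun x y => if x == y
                       then (if wire x i then (1 + 'i) / sqrtC 2 else 1)
                       else 0)
  | GateCNOT c t =>
      if c != t then opmx (fun x y => (x == flip t (wire y c) y)%:R)
      else 1%:M
  end.

(* The head of the list is the gate applied first. *)
Definition circuit_mx (R : rcfType) (w : nat) (gs : seq gate) :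
    operator R 'I_w :=
  foldl (fun U g => gate_mx R w g *m U) 1%:M gs.

(* [k] copies of [rho] and [a] ancillas in state |0>: qubit [i] of copy [j] is
   wire [j * n + i], and the ancillas are the last [a] wires. *)
Definition input_state (R : rcfType) (n k a : nat) (rho : operator R 'I_n) :
    operator R 'I_(k * n + a) :=
  let copy (j : 'I_k) (x : bits 'I_(k * n + a)) : bits 'I_n :=
    [ffun i : 'I_n => wire x (j * n + i)] in
  let ancillas0 (x : bits 'I_(k * n + a)) :=
    [forall m : 'I_a, ~~ wire x (k * n + m)] in
  opmx (fun x y => if ancillas0 x && ancillas0 y
                   then \prod_(j < k) entry rho (copy j x) (copy j y)
                   else 0).

(* Born rule for measuring every wire in the computational basis. *)
Definition outcome_prob (R : rcfType) (n k a : nat) (gs : seq gate)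
    (rho : operator R 'I_n) (z : bits 'I_(k * n + a)) : R :=
  let U := circuit_mx R (k * n + a) gs in
  complex.Re (entry (U *m input_state k a rho *m U^t*) z z).

(** ** Classical control: random-access machine programs

   The memory is an infinite array of natural numbers and every instruction
   and every test costs one step.  Arithmetic is restricted to addition and
   truncated subtraction, so that unit cost is polynomially equivalent to
   Turing machine time on inputs of polynomial bit length. *)

Inductive instr : Type :=
| Const  of nat & nat          (* mem[x] := c *)
| Add    of nat & nat & nat    (* mem[x] := mem[y] + mem[z] *)
| Sub    of nat & nat & nat    (* mem[x] := mem[y] - mem[z] *)
| Fetch  of nat & nat          (* mem[x] := mem[mem[y]] *)
| Store  of nat & nat          (* mem[mem[x]] := mem[y] *)
| Input  of nat & nat          (* mem[x] := input[mem[y]] *)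
| Result of nat & nat          (* mem[x] := measured bit of wire mem[y] *)
| EmitH  of nat                (* append H on wire mem[x] *)
| EmitT  of nat                (* append T on wire mem[x] *)
| EmitCNOT of nat & nat.       (* append CNOT, control mem[x], target mem[y] *)

Inductive prog : Type :=
| Skip
| Do of instr
| Seq of prog & prog
| IfNZ of nat & prog & prog    (* branch on mem[x] != 0 *)
| WhileNZ of nat & prog.       (* loop while mem[x] != 0 *)

Record config : Type := Config { memory : nat -> nat; circ : seq gate }.

Definition config0 : config := Config (fun=> 0%N) [::].

Definition write (s : config) (x v : nat) : config :=
  Config (fun y => if y == x then v else memory s y) (circ s).

Definition emit (s : config) (g : gate) : config :=
  Config (memory s) (rcons (circ s) g).

Definition exec_instr (inp : nat -> nat) (res : nat -> bool) (i : instr)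
    (s : config) : config :=
  let M := memory s in
  match i with
  | Const x c => write s x c
  | Add x y z => write s x (M y + M z)%N
  | Sub x y z => write s x (M y - M z)%N
  | Fetch x y => write s x (M (M y))
  | Store x y => write s (M x) (M y)
  | Input x y => write s x (inp (M y))
  | Result x y => write s x (res (M y))
  | EmitH x => emit s (GateH (M x))
  | EmitT x => emit s (GateT (M x))
  | EmitCNOT x y => emit s (GateCNOT (M x) (M y))
  end.

(* [exec inp res c s t s']: from [s], [c] halts in [s'] after [t] steps. *)
Inductive exec (inp : nat -> nat) (res : nat -> bool) :
    prog -> config -> nat -> config -> Prop :=
| ExecSkip s : exec inp res Skip s 1 s
| ExecDo i s : exec inp res (Do i) s 1 (exec_instr inp res i s)
| ExecSeq c1 c2 s1 s2 s3 t1 t2 :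
    exec inp res c1 s1 t1 s2 -> exec inp res c2 s2 t2 s3 ->
    exec inp res (Seq c1 c2) s1 (t1 + t2) s3
| ExecIfT x c1 c2 s s' t :
    memory s x != 0%N -> exec inp res c1 s t s' ->
    exec inp res (IfNZ x c1 c2) s t.+1 s'
| ExecIfF x c1 c2 s s' t :
    memory s x = 0%N -> exec inp res c2 s t s' ->
    exec inp res (IfNZ x c1 c2) s t.+1 s'
| ExecWhileT x c s1 s2 s3 t1 t2 :
    memory s1 x != 0%N -> exec inp res c s1 t1 s2 ->
    exec inp res (WhileNZ x c) s2 t2 s3 ->
    exec inp res (WhileNZ x c) s1 (t1 + t2).+1 s3
| ExecWhileF x c s :
    memory s x = 0%N -> exec inp res (WhileNZ x c) s 1 s.

(** ** Quantum algorithms *)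

(* A quantum algorithm first runs [prep], which emits a circuit and leaves the
   number of copies in cell 0 and the number of ancillas in cell 1.  The
   circuit is applied to the copies and the ancillas, and all wires are
   measured.  Then [decide] runs from the final memory of [prep] with access to
   the measured bits, and accepts when it halts with a nonzero cell 0.
   The programs do not depend on the instance: this is a uniform model.
   [precision] is the resolution, as a function of the number of qubits, at
   which the algorithm reads real parameters. *)
Record qalgorithm : Type := QAlgorithm {
  prep : prog;
  decide : prog;
  precision : {poly nat}
}.

(* A machine can only read finitely many digits of a real threshold: the
   thresholds are given as multiples of [1 / D], rounded down. *)
Definition instance (R : realType) (D : nat) (n : nat) (A : {set 'I_n})
    (r : nat) (eps1 eps2 : R) (m : nat) : nat :=
  match m with
  | 0 => n
  | 1 => r
  | 2 => Num.truncn (eps1 * D%:R)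
  | 3 => Num.truncn (eps2 * D%:R)
  | m'.+4 => if insub m' is Some i then nat_of_bool (i \in A) else 0%N
  end.

Definition accepts (inp : nat -> nat) (c : prog) (s : config) (w : nat)
    (z : bits 'I_w) : Prop :=
  exists (t : nat) (s' : config),
    exec inp (wire z) c s t s' /\ memory s' 0 != 0%N.

(* On the instance [inp], run on copies of the [n]-qubit state [rho], [alg]
   halts within [T] steps on every measurement outcome (preparing a wire counts
   as one step), uses [k] copies and accepts with probability [P]. *)
Definition runs (R : realType) (alg : qalgorithm) (inp : nat -> nat)
    (n : nat) (rho : operator R 'I_n) (T k : nat) (P : R) : Prop :=
  exists (t1 a : nat) (s1 : config),
    [/\ exec inp (fun=> false) (prep alg) config0 t1 s1,
        memory s1 0 = k, memory s1 1 = a,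
        forall z : bits 'I_(k * n + a), exists (t2 : nat) (s2 : config),
          exec inp (wire z) (decide alg) s1 t2 s2
          /\ (t1 + (k * n + a) + t2 <= T)%N
      & P = \sum_(z : bits 'I_(k * n + a)
                    | `[< accepts inp (decide alg) s1 z >])
              outcome_prob (circ s1) rho z].

(* Main.v *)
Require Import Defs.
From mathcomp Require Import all_boot all_order all_algebra.
From mathcomp Require Import spectral sesquilinear complex.
From mathcomp Require Import boolp classical_sets reals.
From mathcomp Require Import zify ring lra.

(* Let T be the realignment of rho: the matrix of rho with its entries indexed by
   (row, column) labels on A against those on B.  The Schmidt coefficients of rho
   are the squared singular values of T divided by P = tr rho^2, so their sum of
   squares is G / P^2 with G = tr (T T^* )^2.  If the overlap of rho with operators of
   Schmidt rank at most r reaches eps1, Cauchy-Schwarz and Bessel give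
   G >= eps1^2 P^2 / r; if it stays below eps2, product operators show that the
   squared operator norm of T is at most eps2 P, so G <= eps2 P^2.

   G is the expectation on four copies of rho of a product of swaps that pairs the
   copies in one way on A and in another way on B; P^2 is the same quantity when A is
   empty.  Each qubit takes part in a single swap, so both are the means of signs
   read off from Bell measurements (CNOT, H) of disjoint pairs of wires.  The
   algorithm compares G with P^2 times the midpoint of eps1^2 / r and eps2, using N
   rounds of eight copies; the gap and Chebyshev's inequality give the number of
   rounds, which the machine computes as the square M^2 of an integer
   M = O(p^2 / (eps1^2 / r - eps2)). *)

Set Implicit Arguments.
Unset Strict Implicit.
Unset Printing Implicit Defensive.

Import Order.TTheory GRing.Theory Num.Theory.

(** * Random-access machine programs *)

Local Open Scope nat_scope.

(** With s_i the singular values of T, the maximal overlap is the sum of the r largest s_i^2 divided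
    by P. It is not a polynomial in rho, whereas G, the sum of the s_i^4, is one of degree four. The
    price is the two inequalities around G: Cauchy-Schwarz over r coefficients costs the square and
    the 1/r on eps1, and bounding every s_i by the largest gives eps2. Hence the form of the
    promise. P is unknown. Since each round yields one sign of mean G and one of mean P^2, the
    decision is the sign of one linear statistic of mean N (G - c P^2), and no estimate of P is
    divided by. Its variance is at most N (1 + c^2) <= 2N, while its mean stays N delta P^2 / 4 away
    from 0, where delta = eps1^2 / r - eps2. The error is thus at most 32 / (N delta^2 P^4), and
    with P >= 1/p the square root of N has to be of order p^2 / delta. Taking N = M^2 leaves the
    machine a single division and no root. The rank r is an unrestricted input, yet the gap forces r
    <= q(n); this is what keeps the running time polynomial in n. *)

Section Exec.
Variables (inp : nat -> nat) (res : nat -> bool).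
Notation exec := (exec inp res).

(** Acceptance is the existence of an accepting run, so showing that an outcome is rejected requires
    uniqueness of the run. *)
Lemma exec_det c s t1 s1 : exec c s t1 s1 ->
  forall t2 s2, exec c s t2 s2 -> t1 = t2 /\ s1 = s2.
Proof.
elim=> {c s t1 s1} *; match goal with H : Defs.exec _ _ _ _ _ ?s |- _ = _ /\ _ = ?s =>
    inversion H; subst end => //;
  repeat match goal with
    IH : forall t s, Defs.exec _ _ ?c ?s0 t s -> _ = _ /\ _ = _, H : Defs.exec _ _ ?c ?s0 _ _ |- _ =>
      have [? ?] := IH _ _ H; clear IH; subst end => //;
  by match goal with nz : is_true (?x != _), z : ?x = _ |- _ => rewrite z in nz end.
Qed.

Inductive expr : Type :=
| EVar of nat
| ECst of nat
| EAdd of expr & expr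
| ESub of expr & expr
| EMul of expr & expr.

Fixpoint eval (m : nat -> nat) (e : expr) : nat :=
  match e with
  | EVar x => m x
  | ECst c => c
  | EAdd a b => eval m a + eval m b
  | ESub a b => eval m a - eval m b
  | EMul a b => eval m a * eval m b
  end.

(** A product is a loop of additions: three steps per unit of the first factor (test, addition,
    decrement), plus two constants and the failing test. Costs therefore depend on values. *)
Fixpoint cost (m : nat -> nat) (e : expr) : nat :=
  match e with
  | EVar _ => 2
  | ECst _ => 1
  | EAdd a b | ESub a b => cost m a + cost m b + 1
  | EMul a b => cost m a + cost m b + 3 * eval m a + 3
  end.

Fixpoint scoped (v : nat) (e : expr) : bool :=
  match e with
  | EVar x => x < v
  | ECst _ => true
  | EAdd a b | ESub a b | EMul a b => scoped v a && scoped v b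
  end.

(* Leaves the value of [e] in cell [d]; cells below [d] are preserved, and cells
   above [d] are scratch space. *)
Fixpoint compile (e : expr) (d : nat) : prog :=
  match e with
  | EVar x => Seq (Do (Const d 0)) (Do (Add d x d))
  | ECst c => Do (Const d c)
  | EAdd a b => Seq (compile a d) (Seq (compile b d.+1) (Do (Add d d d.+1)))
  | ESub a b => Seq (compile a d) (Seq (compile b d.+1) (Do (Defs.Sub d d d.+1)))
  | EMul a b =>
      Seq (compile a d.+1) (Seq (compile b d.+2)
      (Seq (Do (Const d 0)) (Seq (Do (Const d.+3 1))
      (WhileNZ d.+1 (Seq (Do (Add d d d.+2)) (Do (Defs.Sub d.+1 d.+1 d.+3)))))))
  end.

Lemma eq_eval v m m' e : scoped v e -> (forall x, x < v -> m x = m' x) ->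
  eval m e = eval m' e.
Proof.
move=> + mm'; elim: e => //= [a IHa b IHb|a IHa b IHb|a IHa b IHb] /andP[/IHa -> /IHb -> //].
Qed.

Lemma eq_cost v m m' e : scoped v e -> (forall x, x < v -> m x = m' x) ->
  cost m e = cost m' e.
Proof.
move=> + mm'; elim: e => //= a IHa b IHb /andP[sa sb]; rewrite IHa ?IHb //.
by rewrite (eq_eval sa mm').
Qed.

Lemma exec_mul_loop d s :
  memory s d.+3 = 1 ->
  exists t s', [/\ exec (WhileNZ d.+1 (Seq (Do (Add d d d.+2)) (Do (Defs.Sub d.+1 d.+1 d.+3)))) s t s',
    t = 3 * memory s d.+1 + 1,
    memory s' d = memory s d + memory s d.+1 * memory s d.+2,
    (forall x, x < d -> memory s' x = memory s x) & circ s' = circ s].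
Proof.
move: {2}(memory s d.+1) (erefl (memory s d.+1)) => y.
elim: y s => [|y IH] s sy s1.
  exists 1, s; split=> //; first exact: ExecWhileF.
  - by rewrite sy.
  - by rewrite sy mul0n addn0.
set s2 := exec_instr inp res (Defs.Sub d.+1 d.+1 d.+3) (exec_instr inp res (Add d d d.+2) s).
have E1 : (d.+1 == d) = false by lia.
have E2 : (d.+2 == d) = false by lia.
have E3 : (d.+3 == d) = false by lia.
have E4 : (d.+3 == d.+1) = false by lia.
have E5 : (d.+2 == d.+1) = false by lia.
have E6 : (d == d.+1) = false by lia.
have [||t [s' [X1 X2 X3 X4 X5]]] := IH s2.
- by rewrite /s2 /= eqxx E1 E3 sy s1; lia.
- by rewrite /s2 /= E4 E3.
exists (1 + 1 + t).+1, s'; split.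
- apply: ExecWhileT X1; first by rewrite sy.
  exact: ExecSeq (ExecDo _ _ _ _) (ExecDo _ _ _ _).
- by rewrite X2 /s2 /= eqxx E1 E3 sy s1; lia.
- rewrite X3 /s2 /= !eqxx E1 E2 E3 E5 E6 sy s1; lia.
- move=> x xd; rewrite X4 // /s2 /= (_ : (x == d.+1) = false) 1?(_ : (x == d) = false) //; lia.
- by rewrite X5.
Qed.

Lemma exec_compile e d s : scoped d e ->
  exists t s', [/\ exec (compile e d) s t s', t = cost (memory s) e,
    memory s' d = eval (memory s) e,
    (forall x, x < d -> memory s' x = memory s x) & circ s' = circ s].
Proof.
have mono v w e' : v <= w -> scoped v e' -> scoped w e'.
  move=> vw; elim: e' => //= [x xv|a IHa b IHb|a IHa b IHb|a IHa b IHb].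
  - exact: leq_trans xv vw.
  - by move=> /andP[/IHa -> /IHb ->].
  - by move=> /andP[/IHa -> /IHb ->].
  - by move=> /andP[/IHa -> /IHb ->].
elim: e d s => [x|c|a IHa b IHb|a IHa b IHb|a IHa b IHb] d s /=.
- move=> xd; exists 2, (exec_instr inp res (Add d x d) (exec_instr inp res (Const d 0) s)); split=> //.
  + exact: ExecSeq (ExecDo _ _ _ _) (ExecDo _ _ _ _).
  + by rewrite /= !eqxx (_ : (x == d) = false) ?addn0 //; lia.
  + by move=> y yd /=; rewrite (_ : (y == d) = false) //; lia.
- move=> _; exists 1, (exec_instr inp res (Const d c) s); split=> //; first exact: ExecDo.
  + by rewrite /= eqxx.
  + by move=> y yd /=; rewrite (_ : (y == d) = false) //; lia.
- move=> /andP[sa sb]; have [t1 [s1 [A1 A2 A3 A4 A5]]] := IHa d s sa.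
  have [t2 [s2 [B1 B2 B3 B4 B5]]] := IHb d.+1 s1 (mono _ _ _ (leqnSn _) sb).
  exists (t1 + (t2 + 1)), (exec_instr inp res (Add d d d.+1) s2); split.
  + exact: ExecSeq A1 (ExecSeq B1 (ExecDo _ _ _ _)).
  + by rewrite A2 B2 (eq_cost sb A4); lia.
  + by rewrite /= eqxx B3 B4 // A3 (eq_eval sb A4).
  + by move=> y yd /=; rewrite (_ : (y == d) = false) ?B4 ?A4 //; lia.
  + by rewrite /= B5.
- move=> /andP[sa sb]; have [t1 [s1 [A1 A2 A3 A4 A5]]] := IHa d s sa.
  have [t2 [s2 [B1 B2 B3 B4 B5]]] := IHb d.+1 s1 (mono _ _ _ (leqnSn _) sb).
  exists (t1 + (t2 + 1)), (exec_instr inp res (Defs.Sub d d d.+1) s2); split.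
  + exact: ExecSeq A1 (ExecSeq B1 (ExecDo _ _ _ _)).
  + by rewrite A2 B2 (eq_cost sb A4); lia.
  + by rewrite /= eqxx B3 B4 // A3 (eq_eval sb A4).
  + by move=> y yd /=; rewrite (_ : (y == d) = false) ?B4 ?A4 //; lia.
  + by rewrite /= B5.
- move=> /andP[sa sb]; have [t1 [s1 [A1 A2 A3 A4 A5]]] := IHa d.+1 s (mono _ _ _ (leqnSn _) sa).
  have [t2 [s2 [B1 B2 B3 B4 B5]]] := IHb d.+2 s1 (mono _ _ _ (leqW (leqnSn d)) sb).
  set s3 := exec_instr inp res (Const d.+3 1) (exec_instr inp res (Const d 0) s2).
  have s3d3 : memory s3 d.+3 = 1 by rewrite /= eqxx.
  have [t4 [s4 [C1 C2 C3 C4 C5]]] := exec_mul_loop s3d3.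
  have A4' x : x < d -> memory s1 x = memory s x by move=> ?; apply: A4; lia.
  have s3d1 : memory s3 d.+1 = eval (memory s) a.
    rewrite /s3 /= (_ : (d.+1 == d.+3) = false) 1?(_ : (d.+1 == d) = false); try lia.
    by rewrite B4.
  have s3d2 : memory s3 d.+2 = eval (memory s) b.
    rewrite /s3 /= (_ : (d.+2 == d.+3) = false) 1?(_ : (d.+2 == d) = false); try lia.
    by rewrite B3 (eq_eval sb A4').
  have s3d : memory s3 d = 0.
    by rewrite /s3 /= (_ : (d == d.+3) = false) 1?eqxx //; lia.
  exists (t1 + (t2 + (1 + (1 + t4)))), s4; split.
  + exact: ExecSeq A1 (ExecSeq B1 (ExecSeq (ExecDo _ _ _ _) (ExecSeq (ExecDo _ _ _ _) C1))).
  + by rewrite A2 B2 C2 s3d1 (eq_cost sb A4'); lia.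
  + by rewrite C3 s3d s3d1 s3d2.
  + move=> y yd; rewrite C4 // /s3 /= (_ : (y == d.+3) = false) 1?(_ : (y == d) = false); try lia.
    by rewrite B4 ?A4' //; lia.
  + by rewrite C5 /= B5.
Qed.

(* Only the cells below [size e] are described, so that the scratch space used
   by [compile] does not appear in specifications. *)
Definition holds_regs (s : config) (e : seq nat) (gs : seq gate) : Prop :=
  (forall x, x < size e -> memory s x = nth 0 e x) /\ circ s = gs.

(** A Hoare triple between concrete register files. The time is only an upper bound, so that all
    passes of a loop can be given the same cost. *)
Definition steps (c : prog) (e : seq nat) (gs : seq gate) (t : nat)
    (e' : seq nat) (gs' : seq gate) : Prop :=
  forall s, holds_regs s e gs ->
  exists t' s', [/\ exec c s t' s', t' <= t & holds_regs s' e' gs'].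

Lemma steps_le c e gs t t' e' gs' :
  t <= t' -> steps c e gs t e' gs' -> steps c e gs t' e' gs'.
Proof.
move=> tt' H s /H[t2 [s' [X1 X2 X3]]]; exists t2, s'; split=> //.
exact: leq_trans X2 tt'.
Qed.

Lemma steps_seq c1 c2 e1 gs1 t1 e2 gs2 t2 e3 gs3 :
  steps c1 e1 gs1 t1 e2 gs2 -> steps c2 e2 gs2 t2 e3 gs3 ->
  steps (Seq c1 c2) e1 gs1 (t1 + t2) e3 gs3.
Proof.
move=> H1 H2 s /H1[u1 [s1 [X1 X2 /H2[u2 [s2 [Y1 Y2 Y3]]]]]].
exists (u1 + u2), s2; split=> //; first exact: ExecSeq X1 Y1.
exact: leq_add.
Qed.

(** The loop follows an explicit trajectory [E], [G] in place of an invariant. Each pass pays one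
    step for its test; the last step is the failing test. *)
Lemma steps_while x c (E : nat -> seq nat) (G : nat -> seq gate) cnt t :
  (forall j, j <= cnt -> x < size (E j)) ->
  (forall j, j < cnt -> nth 0 (E j) x != 0) -> nth 0 (E cnt) x = 0 ->
  (forall j, j < cnt -> steps c (E j) (G j) t (E j.+1) (G j.+1)) ->
  steps (WhileNZ x c) (E 0) (G 0) (cnt * t.+1).+1 (E cnt) (G cnt).
Proof.
elim: cnt E G => [|cnt IH] E G szE nzE zE bodyE s [sE sG].
  exists 1, s; split=> //; apply: ExecWhileF.
  by rewrite sE ?szE.
have [t1 [s1 [X1 X2 X3]]] := bodyE 0 (ltn0Sn _) s (conj sE sG).
have [||||t2 [s2 [Y1 Y2 Y3]]] := IH (fun j => E j.+1) (fun j => G j.+1) _ _ _ _ s1 X3.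
- by move=> j jc; apply: szE.
- by move=> j jc; apply: nzE.
- exact: zE.
- by move=> j jc; apply: bodyE.
exists (t1 + t2).+1, s2; split=> //; last by rewrite mulSn; lia.
by apply: ExecWhileT X1 Y1; rewrite sE ?szE // nzE.
Qed.

Inductive op : Type :=
| OSet of nat & expr
| OInput of nat & nat
| OResult of nat & nat
| OEmitCNOT of nat & nat
| OEmitH of nat.

(** * Straight-line code on a fixed register file *)

Section Straight.
Variable S : nat.

(** The value is built in cell [S], the first scratch cell, and only then moved to [x], so that [x]
    may occur in the expression of its own new value. *)
Definition op_prog (o : op) : prog :=
  match o with
  | OSet x e => Seq (compile e S) (Seq (Do (Const x 0)) (Do (Add x S x)))
  | OInput x y => Do (Input x y)
  | OResult x y => Do (Result x y)
  | OEmitCNOT x y => Do (EmitCNOT x y)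
  | OEmitH x => Do (EmitH x)
  end.

Definition op_scoped (o : op) : bool :=
  match o with
  | OSet x e => (x < S) && scoped S e
  | OInput x y | OResult x y | OEmitCNOT x y => (x < S) && (y < S)
  | OEmitH x => x < S
  end.

Definition op_regs (o : op) (e : seq nat) : seq nat :=
  match o with
  | OSet x a => set_nth 0 e x (eval (nth 0 e) a)
  | OInput x y => set_nth 0 e x (inp (nth 0 e y))
  | OResult x y => set_nth 0 e x (res (nth 0 e y))
  | _ => e
  end.

Definition op_gates (o : op) (e : seq nat) : seq gate :=
  match o with
  | OEmitCNOT x y => [:: GateCNOT (nth 0 e x) (nth 0 e y)]
  | OEmitH x => [:: GateH (nth 0 e x)]
  | _ => [::]
  end.

Definition op_cost (o : op) (e : seq nat) : nat :=
  if o is OSet _ a then cost (nth 0 e) a + 2 else 1.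

Lemma size_op_regs o e : size e = S -> op_scoped o -> size (op_regs o e) = S.
Proof.
by case: o => [x a|x y|x y|x y|x] /= <- //= /andP[xS _];
  rewrite size_set_nth; apply/maxn_idPr.
Qed.

Lemma steps_op o e gs : size e = S -> op_scoped o ->
  steps (op_prog o) e gs (op_cost o e) (op_regs o e) (gs ++ op_gates o e).
Proof.
move=> szS oS s [sE sG]; have eqm x : x < S -> memory s x = nth 0 e x.
  by rewrite -szS; apply: sE.
case: o oS => [x a|x y|x y|x y|x] /=.
- move=> /andP[xS aS]; have [t [s' [A1 A2 A3 A4 A5]]] := exec_compile s aS.
  exists (t + (1 + 1)), (exec_instr inp res (Add x S x) (exec_instr inp res (Const x 0) s')); split.
  + exact: ExecSeq A1 (ExecSeq (ExecDo _ _ _ _) (ExecDo _ _ _ _)).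
  + by rewrite A2 (eq_cost aS eqm).
  + split=> [y|/=]; last by rewrite A5 sG cats0.
    rewrite size_set_nth (maxn_idPr _) ?szS // => yS.
    rewrite nth_set_nth /=; case: eqP => _; last by rewrite A4 // eqm.
    rewrite eqxx (_ : (S == x) = false) ?addn0; last by lia.
    by rewrite A3 (eq_eval aS eqm).
- move=> /andP[xS yS]; exists 1, (exec_instr inp res (Input x y) s); split=> //.
    exact: ExecDo.
  split=> [z|/=]; last by rewrite cats0.
  rewrite size_set_nth (maxn_idPr _) ?szS // => zS.
  by rewrite nth_set_nth /=; case: eqP => _; rewrite eqm.
- move=> /andP[xS yS]; exists 1, (exec_instr inp res (Result x y) s); split=> //.
    exact: ExecDo.
  split=> [z|/=]; last by rewrite cats0.
  rewrite size_set_nth (maxn_idPr _) ?szS // => zS.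
  by rewrite nth_set_nth /=; case: eqP => _; rewrite eqm.
- move=> /andP[xS yS]; exists 1, (exec_instr inp res (EmitCNOT x y) s); split=> //.
    exact: ExecDo.
  by split=> [z zS|/=]; [exact: sE|rewrite sG !eqm // cats1].
- move=> xS; exists 1, (exec_instr inp res (EmitH x) s); split=> //.
    exact: ExecDo.
  by split=> [z zS|/=]; [exact: sE|rewrite sG !eqm // cats1].
Qed.

Fixpoint block (os : seq op) : prog :=
  if os is o :: os' then Seq (op_prog o) (block os') else Skip.

Fixpoint block_regs (os : seq op) (e : seq nat) : seq nat :=
  if os is o :: os' then block_regs os' (op_regs o e) else e.

Fixpoint block_gates (os : seq op) (e : seq nat) : seq gate :=
  if os is o :: os' then op_gates o e ++ block_gates os' (op_regs o e) else [::].

Fixpoint block_cost (os : seq op) (e : seq nat) : nat :=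
  if os is o :: os' then op_cost o e + block_cost os' (op_regs o e) else 1.

Lemma steps_block os e gs : size e = S -> all op_scoped os ->
  steps (block os) e gs (block_cost os e) (block_regs os e) (gs ++ block_gates os e).
Proof.
elim: os e gs => [|o os IH] e gs szS /=.
  by move=> _ s sE; exists 1, s; split=> //; [exact: ExecSkip|rewrite cats0].
move=> /andP[oS osS]; rewrite catA.
apply: steps_seq; first exact: steps_op.
by apply: IH => //; apply: size_op_regs.
Qed.

End Straight.
End Exec.

(** * The sweep over all pairs of qubits *)

Local Notation "a +! b" := (EAdd a b) (at level 50, left associativity).
Local Notation "a *! b" := (EMul a b) (at level 40, left associativity).
Local Notation "# x" := (EVar x) (at level 5, format "# x").

Lemma block_regs_cat inp res o1 o2 e :
  block_regs inp res (o1 ++ o2) e = block_regs inp res o2 (block_regs inp res o1 e).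
Proof. by elim: o1 e => //= o o1 IH e. Qed.

Lemma block_gates_cat inp res o1 o2 e :
  block_gates inp res (o1 ++ o2) e =
  block_gates inp res o1 e ++ block_gates inp res o2 (block_regs inp res o1 e).
Proof. by elim: o1 e => //= o o1 IH e; rewrite IH catA. Qed.

Lemma block_cost_cat inp res o1 o2 e :
  block_cost inp res (o1 ++ o2) e <=
  block_cost inp res o1 e + block_cost inp res o2 (block_regs inp res o1 e).
Proof. by elim: o1 e => [|o o1 IH] e /=; [lia|move: (IH (op_regs inp res o e)); lia]. Qed.

(** In [env], [pcopies] and the 0 after it fill the two cells from which [runs] reads the numbers of
    copies and of ancillas. *)
Record params : Type := Params {
  pcopies : nat; pn : nat; pr : nat; pe1 : nat; pe2 : nat;
  pD : nat; pM : nat; pN : nat; pd : nat }.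

(* Parities of the current round, and numbers of past rounds of odd parity, for
   the two halves A and B of a round. *)
Record counters : Type := Counters { parA : bool; parB : bool; cntA : nat; cntB : nat }.

Definition nregs := 23.

(* Registers 9 to 12 drive the loops (remaining rounds, base wire of the round,
   current qubit, remaining qubits); 13 to 17 hold the mask bit, the two strides
   and the two wires of the current pair, and are zero between qubits. *)
Definition env (F : params) (cnt base i icnt m s w c t : nat) (a : counters) : seq nat :=
  [:: pcopies F; 0; pn F; pr F; pe1 F; pe2 F; pD F; pM F; pN F;
      cnt; base; i; icnt; m; s; w; c; t;
      nat_of_bool (parA a); nat_of_bool (parB a); cntA a; cntB a; pd F].

(* Round [b] uses eight copies: [h] selects the half of the round, and the four
   copies of a half are labelled by two bits [al], [be]. *)
Definition wire_no (n b : nat) (h al be : bool) (i : nat) : nat :=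
  (8 * b + 4 * h + 2 * al + be) * n + i.

(* In the first half of a round, the qubits in the mask are paired along [al] and
   the others along [be]; in the second half all qubits are paired along [be]. *)
Definition pair_src (mask : nat -> bool) (n b i : nat) (h g : bool) : nat :=
  if ~~ h && mask i then wire_no n b h false g i else wire_no n b h g false i.
Definition pair_tgt (mask : nat -> bool) (n b i : nat) (h g : bool) : nat :=
  if ~~ h && mask i then wire_no n b h true g i else wire_no n b h g true i.

Definition halves : seq (bool * bool) :=
  [:: (false, false); (false, true); (true, false); (true, true)].

Section Sweep.
Variables (inp : nat -> nat) (res : nat -> bool) (F : params) (mask : nat -> bool).
Hypothesis inp_mask : forall i, i < pn F -> inp i.+4 = mask i.
Variables (act : bool -> seq op) (actf : bool -> nat -> nat -> counters -> counters)
          (actg : nat -> nat -> seq gate) (tact : nat).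
Hypothesis act_scoped : forall h, all (op_scoped nregs) (act h).
Hypothesis act_regs : forall h cnt base i icnt m s w c t a,
  block_regs inp res (act h) (env F cnt base i icnt m s w c t a)
  = env F cnt base i icnt m s w 0 0 (actf h c t a).
Hypothesis act_gates : forall h cnt base i icnt m s w c t a,
  block_gates inp res (act h) (env F cnt base i icnt m s w c t a) = actg c t.
Hypothesis act_cost : forall h cnt base i icnt m s w c t a,
  block_cost inp res (act h) (env F cnt base i icnt m s w c t a) <= tact.
Variables (fin : seq op) (finf : counters -> counters) (tfin : nat).
Hypothesis fin_scoped : all (op_scoped nregs) fin.
Hypothesis fin_regs : forall cnt base i icnt m s w c t a,
  block_regs inp res fin (env F cnt base i icnt m s w c t a)
  = env F cnt base i icnt m s w c t (finf a).
Hypothesis fin_gates : forall e, block_gates inp res fin e = [::].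
Hypothesis fin_cost : forall cnt base i icnt m s w c t a,
  block_cost inp res fin (env F cnt base i icnt m s w c t a) <= tfin.

Definition pair_ops (h : bool) (c st : expr) : seq op :=
  [:: OSet 16 c; OSet 17 (#16 +! st)] ++ act h.

(** Branch-free use of the mask bit m: register 14 is the distance n + m n between the two wires of
    a pair, register 15 the distance 2n - m n between the two pairs of the first half. For m = 1
    these are 2n and n (pairing along [al]), for m = 0 they are n and 2n (pairing along [be]). The
    second half starts 4n further and always pairs at distance n. *)
Definition qubit_ops : seq op :=
  [:: OSet 13 (#11 +! ECst 4); OInput 13 13;
      OSet 14 (#2 +! (#13 *! #2)); OSet 15 (ESub (#2 +! #2) (#13 *! #2))]
  ++ (pair_ops false (#10 +! #11) #14
  ++ (pair_ops false (#10 +! #11 +! #15) #14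
  ++ (pair_ops true (#10 +! #11 +! (#2 +! #2 +! (#2 +! #2))) #2
  ++ (pair_ops true (#10 +! #11 +! (#2 +! #2 +! (#2 +! #2)) +! (#2 +! #2)) #2
  ++ [:: OSet 13 (ECst 0); OSet 14 (ECst 0); OSet 15 (ECst 0);
         OSet 11 (#11 +! ECst 1); OSet 12 (ESub #12 (ECst 1))])))).

Definition block_ops : seq op :=
  fin ++ [:: OSet 11 (ECst 0);
    OSet 10 (#10 +! (#2 +! #2 +! (#2 +! #2) +! (#2 +! #2 +! (#2 +! #2))));
    OSet 9 (ESub #9 (ECst 1))].

(** Used twice, to emit the gates and later to read the outcomes, so that both passes visit the same
    pairs of wires by construction. *)
Definition sweep : prog :=
  Seq (block nregs [:: OSet 10 (ECst 0); OSet 9 #8])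
      (WhileNZ 9 (Seq (block nregs [:: OSet 12 #2])
                 (Seq (WhileNZ 12 (block nregs qubit_ops)) (block nregs block_ops)))).

Definition qubit_step (b : nat) (a : counters) (i : nat) : counters :=
  foldl (fun a q => actf q.1 (pair_src mask (pn F) b i q.1 q.2)
                             (pair_tgt mask (pn F) b i q.1 q.2) a) a halves.

Definition block_step (a : counters) (b : nat) : counters :=
  finf (foldl (qubit_step b) a (iota 0 (pn F))).

Definition qubit_gates (b i : nat) : seq gate :=
  flatten [seq actg (pair_src mask (pn F) b i q.1 q.2)
                    (pair_tgt mask (pn F) b i q.1 q.2) | q <- halves].

Definition sweep_gates (nb : nat) : seq gate :=
  flatten [seq flatten [seq qubit_gates b i | i <- iota 0 (pn F)] | b <- iota 0 nb].

Lemma pair_ops_ok h c st cnt base i icnt m s w a cv tv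
  (e := env F cnt base i icnt m s w 0 0 a) :
  eval (nth 0 e) c = cv -> cv + eval (nth 0 (set_nth 0 e 16 cv)) st = tv ->
  cost (nth 0 e) c + cost (nth 0 (set_nth 0 e 16 cv)) st <= 50 ->
  [/\ block_regs inp res (pair_ops h c st) e
      = env F cnt base i icnt m s w 0 0 (actf h cv tv a),
      block_gates inp res (pair_ops h c st) e = actg cv tv
    & block_cost inp res (pair_ops h c st) e <= 60 + tact].
Proof.
move=> Ec Et Ek; rewrite /pair_ops.
set o1 := [:: _; _].
have r1 : block_regs inp res o1 e = env F cnt base i icnt m s w cv tv a.
  by rewrite /o1 /block_regs /op_regs Ec /= -Et.
have c1 : block_cost inp res o1 e <= 60.
  rewrite /o1 /block_cost /op_cost [op_regs _ _ (OSet 16 c) e]/op_regs Ec.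
  move: Ek; rewrite /=; lia.
have g1 : block_gates inp res o1 e = [::] by [].
rewrite block_regs_cat block_gates_cat r1 g1 act_regs act_gates; split=> //.
apply: (leq_trans (block_cost_cat _ _ _ _ _)); rewrite r1.
exact: leq_add c1 (act_cost _ _ _ _ _ _ _ _ _ _ _).
Qed.

Lemma qubit_ops_ok i cnt b a (n := pn F)
  (e := env F cnt (8 * b * n) i (n - i) 0 0 0 0 0 a) : i < n ->
  [/\ block_regs inp res qubit_ops e
      = env F cnt (8 * b * n) i.+1 (n - i.+1) 0 0 0 0 0 (qubit_step b a i),
      block_gates inp res qubit_ops e = qubit_gates b i
    & block_cost inp res qubit_ops e <= 350 + 4 * tact].
Proof.
move=> ilt; set m := mask i.
set s := n + m * n; set w := n + n - m * n.
set B := 8 * b * n.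
rewrite /qubit_ops.
set o1 := [:: OSet _ _; _; _; _].
have r1 : block_regs inp res o1 e = env F cnt B i (n - i) m s w 0 0 a.
  by rewrite /e /= addn4 inp_mask.
have g1 : block_gates inp res o1 e = [::] by [].
have c1 : block_cost inp res o1 e <= 60.
  by rewrite /e /= addn4 inp_mask // -/m; case: (m).
have Em g : pair_src mask n b i false g =
  if m then wire_no n b false false g i else wire_no n b false g false i by [].
have Em' g : pair_tgt mask n b i false g =
  if m then wire_no n b false true g i else wire_no n b false g true i by [].
pose st h g a := actf h (pair_src mask n b i h g) (pair_tgt mask n b i h g) a.
have [||//|r2 g2 c2] := @pair_ops_ok false (#10 +! #11) #14 cnt B i (n-i) m s w a
   (pair_src mask n b i false false) (pair_tgt mask n b i false false).
- by rewrite Em /wire_no /= /B; case: (m); lia.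
- by rewrite Em Em' /wire_no /= /s; case: (m); lia.
have [||//|r3 g3 c3] := @pair_ops_ok false (#10 +! #11 +! #15) #14 cnt B i (n-i) m s w
   (st false false a) (pair_src mask n b i false true) (pair_tgt mask n b i false true).
- by rewrite Em /wire_no /= /B /w; case: (m); lia.
- by rewrite Em Em' /wire_no /= /s; case: (m); lia.
have [||//|r4 g4 c4] := @pair_ops_ok true (#10 +! #11 +! (#2 +! #2 +! (#2 +! #2))) #2 cnt B i (n-i) m s w
   (st false true (st false false a)) (pair_src mask n b i true false) (pair_tgt mask n b i true false).
- by rewrite /pair_src /wire_no /= /B -/n; lia.
- by rewrite /pair_src /pair_tgt /wire_no /= -/n; lia.
have [||//|r5 g5 c5] := @pair_ops_ok true (#10 +! #11 +! (#2 +! #2 +! (#2 +! #2)) +! (#2 +! #2)) #2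
   cnt B i (n-i) m s w
   (st true false (st false true (st false false a))) (pair_src mask n b i true true) (pair_tgt mask n b i true true).
- by rewrite /pair_src /wire_no /= /B -/n; lia.
- by rewrite /pair_src /pair_tgt /wire_no /= -/n; lia.
(* The four blocks become variables, so that the computations below use only their specifications
   and do not unfold them. *)
move: (pair_ops _ _ _) r2 g2 c2 => o2 r2 g2 c2.
move: (pair_ops _ _ _) r3 g3 c3 => o3 r3 g3 c3.
move: (pair_ops _ _ _) r4 g4 c4 => o4 r4 g4 c4.
move: (pair_ops _ _ _) r5 g5 c5 => o5 r5 g5 c5.
rewrite !block_regs_cat !block_gates_cat r1 g1 r2 g2 r3 g3 r4 g4 r5 g5.
split.
- by rewrite /= subn1 addn1 -subnS.
- by rewrite /qubit_gates /=.
- apply: (leq_trans (block_cost_cat _ _ _ _ _)); rewrite r1.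
  apply: (leq_trans (leq_add c1 (block_cost_cat _ _ _ _ _))); rewrite r2.
  apply: (leq_trans (leq_add (leqnn _) (leq_add c2 (block_cost_cat _ _ _ _ _)))); rewrite r3.
  apply: (leq_trans (leq_add (leqnn _) (leq_add (leqnn _) (leq_add c3 (block_cost_cat _ _ _ _ _))))); rewrite r4.
  apply: (leq_trans (leq_add (leqnn _) (leq_add (leqnn _)
    (leq_add (leqnn _) (leq_add c4 (block_cost_cat _ _ _ _ _)))))); rewrite r5.
  set y := (X in _ + (_ + (_ + (_ + (_ + X)))) <= _).
  have : y <= 40 by rewrite /y /=.
  by move: c5; rewrite {1}/st; lia.
Qed.

Lemma steps_qubits cnt b a gs (n := pn F) :
  steps inp res (WhileNZ 12 (block nregs qubit_ops))
    (env F cnt (8 * b * n) 0 n 0 0 0 0 0 a) gs (n * (351 + 4 * tact)).+1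
    (env F cnt (8 * b * n) n 0 0 0 0 0 0 (foldl (qubit_step b) a (iota 0 n)))
    (gs ++ flatten [seq qubit_gates b i | i <- iota 0 n]).
Proof.
pose E j := env F cnt (8 * b * n) j (n - j) 0 0 0 0 0 (foldl (qubit_step b) a (iota 0 j)).
pose G j := gs ++ flatten [seq qubit_gates b i | i <- iota 0 j].
have -> : env F cnt (8 * b * n) 0 n 0 0 0 0 0 a = E 0 by rewrite /E subn0.
have -> : env F cnt (8 * b * n) n 0 0 0 0 0 0 (foldl (qubit_step b) a (iota 0 n)) = E n.
  by rewrite /E subnn.
have -> : gs = G 0 by rewrite /G /= cats0.
rewrite -[G 0 ++ _]/((gs ++ [::]) ++ _) cats0 -/(G n).
apply: (@steps_while inp res 12 _ E G n) => //.
- by move=> j jn; rewrite /E /= subn_eq0 -ltnNge.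
- by rewrite /E /= subnn.
move=> j jn.
have [X1 X2 X3] := @qubit_ops_ok j cnt b (foldl (qubit_step b) a (iota 0 j)) jn.
have -> : E j.+1 = block_regs inp res qubit_ops (E j).
  by rewrite /E X1 -[j.+1]addn1 iotaD foldl_cat.
have -> : G j.+1 = G j ++ block_gates inp res qubit_ops (E j).
  by rewrite /E X2 /G -[j.+1]addn1 iotaD map_cat flatten_cat /= cats0 catA.
apply: steps_le (steps_block _ _ _ _) => //.
rewrite /qubit_ops !all_cat; repeat (apply/andP; split=> //).
Qed.

Lemma steps_sweep cnt base a gs (n := pn F) :
  steps inp res sweep (env F cnt base 0 0 0 0 0 0 0 a) gs
    (10 + (pN F * (n * (351 + 4 * tact) + tfin + 100)).+1)
    (env F 0 (8 * pN F * n) 0 0 0 0 0 0 0 (foldl block_step a (iota 0 (pN F))))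
    (gs ++ sweep_gates (pN F)).
Proof.
pose E j := env F (pN F - j) (8 * j * n) 0 0 0 0 0 0 0 (foldl block_step a (iota 0 j)).
pose G j := gs ++ sweep_gates j.
apply: (steps_seq (e2 := E 0) (gs2 := G 0)).
  have -> : E 0 = block_regs inp res [:: OSet 10 (ECst 0); OSet 9 #8] (env F cnt base 0 0 0 0 0 0 0 a).
    by rewrite /E subn0 muln0.
  exact: steps_le (steps_block _ _ _ _).
have -> : env F 0 (8 * pN F * n) 0 0 0 0 0 0 0 (foldl block_step a (iota 0 (pN F))) = E (pN F).
  by rewrite /E subnn.
rewrite -/(G (pN F)).
apply: steps_le; last apply: (@steps_while inp res 9 _ E G (pN F) (n * (351 + 4 * tact) + tfin + 99)) => //.
- by rewrite -addnS.
- by move=> j jn; rewrite /E /= subn_eq0 -ltnNge.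
- by rewrite /E /= subnn.
move=> j jn; set a' := foldl block_step a (iota 0 j).
set e1 := env F (pN F - j) (8 * j * n) 0 n 0 0 0 0 0 a'.
set e2 := env F (pN F - j) (8 * j * n) n 0 0 0 0 0 0 (foldl (qubit_step j) a' (iota 0 n)).
apply: (@steps_le _ _ _ _ _ (5 + ((n * (351 + 4 * tact)).+1 + (tfin + 60)))); first lia.
apply: (steps_seq (e2 := e1) (gs2 := G j)).
  have -> : e1 = block_regs inp res [:: OSet 12 #2] (E j) by [].
  rewrite -[G j in X in steps _ _ _ _ _ _ _ X]cats0.
  apply: steps_le; last exact: (@steps_block inp res nregs [:: OSet 12 #2] (E j) (G j)).
  by [].
apply: (steps_seq (e2 := e2)); first exact: steps_qubits.
have -> : G j ++ flatten [seq qubit_gates j i | i <- iota 0 n] = G j.+1.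
  by rewrite /G /sweep_gates -[j.+1]addn1 iotaD map_cat flatten_cat /= cats0 catA.
have r1 : block_regs inp res block_ops e2 = E j.+1.
  rewrite /block_ops block_regs_cat fin_regs /= /E -[j.+1]addn1 iotaD foldl_cat /=.
  rewrite add0n /block_step -/a' -/n; congr (env _ _ _ _ _ _ _ _ _ _ _); lia.
have g1 : block_gates inp res block_ops e2 = [::].
  by rewrite /block_ops block_gates_cat fin_gates.
have c1 : block_cost inp res block_ops e2 <= tfin + 60.
  apply: (leq_trans (block_cost_cat _ _ _ _ _)); rewrite fin_regs.
  by apply: leq_add (fin_cost _ _ _ _ _ _ _ _ _ _) _.
rewrite -r1 -[X in steps _ _ _ _ _ _ _ X]cats0 -g1.
apply: (steps_le c1); apply: steps_block => //.
by rewrite /block_ops all_cat fin_scoped.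
Qed.

End Sweep.

(** * The two programs *)

(** With every register replaced by a common bound [V], costs become fixed polynomial expressions in
    [V]. Truncated subtraction never exceeds its first argument, which is all that is kept of it. *)
Fixpoint eval_max (V : nat) (e : expr) : nat :=
  match e with
  | EVar _ => V
  | ECst c => c
  | EAdd a b => eval_max V a + eval_max V b
  | ESub a _ => eval_max V a
  | EMul a b => eval_max V a * eval_max V b
  end.

Fixpoint cost_max (V : nat) (e : expr) : nat :=
  match e with
  | EVar _ => 2
  | ECst _ => 1
  | EAdd a b | ESub a b => cost_max V a + cost_max V b + 1
  | EMul a b => cost_max V a + cost_max V b + 3 * eval_max V a + 3
  end.

Lemma eval_maxP V m e : (forall x, m x <= V) -> eval m e <= eval_max V e.
Proof.
move=> mV; elim: e => //= a IHa b IHb; first exact: leq_add.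
- exact: leq_trans (leq_subr _ _) _.
- exact: leq_mul.
Qed.

Lemma cost_maxP V m e : (forall x, m x <= V) -> cost m e <= cost_max V e.
Proof.
move=> mV; elim: e => //= a IHa b IHb; have := eval_maxP a mV; lia.
Qed.

Definition op_cost_max (V : nat) (o : op) : nat :=
  if o is OSet _ a then cost_max V a + 2 else 1.

Definition block_cost_max V os := (sumn (map (op_cost_max V) os)).+1.

Fixpoint bounded inp res V (os : seq op) (e : seq nat) : bool :=
  if os is o :: os' then
    all (fun v => v <= V) e && bounded inp res V os' (op_regs inp res o e)
  else true.

Lemma block_cost_maxP inp res V os e : bounded inp res V os e ->
  block_cost inp res os e <= block_cost_max V os.
Proof.
elim: os e => [|o os IH] e //= /andP[eV osV].
rewrite /block_cost_max /= -addnS leq_add ?IH //.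
case: o {osV} => //= x a; rewrite leq_add2r; apply: cost_maxP => y.
have [ys|ys] := ltnP y (size e); last by rewrite nth_default.
by move/all_nthP: eV; apply.
Qed.

Definition poly_expr (p : {poly nat}) (x : nat) : expr :=
  foldr (fun c e => ECst c +! #x *! e) (ECst 0) (polyseq p).

Lemma eval_poly m p x : eval m (poly_expr p x) = p.[m x]%R.
Proof.
rewrite /poly_expr /horner; elim: (polyseq p) => //= c s ->.
by rewrite addnC mulnC.
Qed.

Lemma scoped_poly v p x : x < v -> scoped v (poly_expr p x).
Proof. by move=> xv; rewrite /poly_expr; elim: (polyseq p) => //= c s ->; rewrite xv. Qed.

Section Programs.
Variables (kap : nat) (p q : {poly nat}).

Definition emit_pair (h : bool) : seq op :=
  [:: OEmitCNOT 16 17; OEmitH 16; OSet 16 (ECst 0); OSet 17 (ECst 0)].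

(** On bits, x + z - 2 x z is the exclusive or; here z is the product of the two outcomes, which is
    1 exactly on the singlet. *)
Definition xor_expr (x : nat) : expr :=
  let zz := #16 *! #17 in ESub (#x +! zz) (#x *! zz +! #x *! zz).

Definition read_pair (h : bool) : seq op :=
  [:: OResult 16 16; OResult 17 17;
      (if h then OSet 19 (xor_expr 19) else OSet 18 (xor_expr 18));
      OSet 16 (ECst 0); OSet 17 (ECst 0)].

Definition close_block : seq op :=
  [:: OSet 20 (#20 +! #18); OSet 18 (ECst 0); OSet 21 (#21 +! #19); OSet 19 (ECst 0)].

(** Register 6 is the resolution D, register 22 approximates D^2 r delta, and register 9 is kap p^2
    r D^2; the quotient of the last two is about kap p^2 / delta, the required square root of the
    number of rounds. *)
Definition setup_ops : seq op :=
  [:: OInput 2 1; OSet 9 (ECst 1); OInput 3 9; OSet 9 (ECst 2); OInput 4 9;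
      OSet 9 (ECst 3); OInput 5 9;
      OSet 6 (ECst 12 *! poly_expr q 2);
      OSet 22 (ESub (#4 *! #4) (#3 *! #5 *! #6));
      OSet 9 (ECst kap *! (poly_expr p 2 *! poly_expr p 2) *! #3 *! (#6 *! #6))].

(* Division by repeated truncated subtraction: register 7 ends up as the ceiling
   of the quotient of registers 9 and 22. *)
Definition divide_ops : seq op := [:: OSet 9 (ESub #9 #22); OSet 7 (#7 +! ECst 1)].
Definition size_ops : seq op := [:: OSet 8 (#7 *! #7); OSet 0 (ECst 8 *! #8)].

Definition prep_prog : prog :=
  Seq (block nregs setup_ops)
 (Seq (WhileNZ 9 (block nregs divide_ops))
 (Seq (block nregs size_ops)
      (sweep emit_pair [::]))).

(* Accepts when [h (N - 2x) >= g (N - 2y)], with the terms moved to keep truncated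
   subtraction exact. *)
Definition verdict_ops : seq op :=
  let g := #4 *! #4 +! #3 *! #5 *! #6 in
  let h := ECst 2 *! #3 *! (#6 *! #6) in
  [:: OSet 0 (ESub (h *! #8 +! g *! (#21 +! #21) +! ECst 1)
                   (g *! #8 +! h *! (#20 +! #20)))].

Definition decide_prog : prog :=
  Seq (sweep read_pair close_block) (block nregs verdict_ops).

Definition pair_gates (c t : nat) : seq gate := [:: GateCNOT c t; GateH c].

Definition read_counters (z : nat -> bool) (h : bool) (c t : nat) (a : counters) : counters :=
  let b := z c && z t in
  if h then Counters (parA a) (parB a (+) b) (cntA a) (cntB a)
  else Counters (parA a (+) b) (parB a) (cntA a) (cntB a).

Definition close_counters (a : counters) : counters :=
  Counters false false (cntA a + parA a) (cntB a + parB a).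

Definition counters0 := Counters false false 0 0.

Section Run.
Variables (inp : nat -> nat) (mask : nat -> bool) (n r e1 e2 M : nat).
Let D := 12 * q.[n]%R.
Let d := e1 * e1 - r * e2 * D.
Let a := kap * (p.[n] * p.[n])%R * r * (D * D).
Let N := M * M.
Hypotheses (inp0 : inp 0 = n) (inp1 : inp 1 = r) (inp2 : inp 2 = e1) (inp3 : inp 3 = e2).
Hypothesis inp_mask : forall i, i < n -> inp i.+4 = mask i.
Hypotheses (M_upper : a <= M * d) (M_lower : forall j, j < M -> j * d < a).
Variable V : nat.
Hypotheses (V0 : 8 <= V) (Vn : n <= V) (Vr : r <= V) (Ve1 : e1 <= V) (Ve2 : e2 <= V)
  (VD : D <= V) (Vd : d <= V) (Va : a <= V) (VM : M <= V) (VN : 8 * N <= V)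
  (Vb : 8 * N * n <= V).

Let F0 := Params 0 n r e1 e2 D 0 0 d.
Definition run_params := Params (8 * N) n r e1 e2 D M N d.

Definition prep_time : nat :=
  block_cost_max V setup_ops + ((V * 20).+1 + (block_cost_max V size_ops
   + (10 + (V * (V * (351 + 4 * 10) + 1 + 100)).+1))).

Lemma steps_prep :
  steps inp (fun=> false) prep_prog (nseq nregs 0) [::] prep_time
    (env run_params 0 (8 * N * n) 0 0 0 0 0 0 0 counters0)
    (sweep_gates run_params mask pair_gates N).
Proof.
pose A j := env (Params 0 n r e1 e2 D j 0 d) (a - j * d) 0 0 0 0 0 0 0 0 counters0.
have rS : block_regs inp (fun=> false) setup_ops (nseq nregs 0) = A 0.
  rewrite /setup_ops /block_regs /op_regs.
  set e := poly_expr p 2; set e' := poly_expr q 2.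
  rewrite /= !inp0 !inp1 !inp2 !inp3 !eval_poly /=.
  by rewrite /A /env /= subn0.
rewrite /prep_prog /prep_time.
apply: (steps_seq (e2 := A 0) (gs2 := [::])).
  rewrite -rS; apply: steps_le; last first.
    apply: steps_block => //; rewrite /setup_ops.
    by rewrite /= !scoped_poly.
  apply: block_cost_maxP.
  rewrite /setup_ops /bounded /op_regs.
  set e := poly_expr p 2; set e' := poly_expr q 2.
  rewrite /= !inp0 !inp1 !inp2 !inp3 !eval_poly /=.
  by do ![apply/andP; split] => //; lia.
(* [M_lower] keeps register 9 nonzero before pass [M], and [M_upper] makes the truncated difference
   0 after it, so the loop runs exactly [M] times and counts them in register 7. *)
apply: (steps_seq (e2 := A M) (gs2 := [::])).
  apply: steps_le; last apply: (@steps_while inp _ 9 _ A (fun=> [::]) M 19) => //.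
  - by rewrite ltnS leq_mul.
  - by move=> j jM; rewrite /A /=; have := M_lower jM; lia.
  - by rewrite /A /=; apply/eqP; rewrite subn_eq0.
  move=> j jM.
  have -> : A j.+1 = block_regs inp (fun=> false) divide_ops (A j).
    by rewrite /A /env /= addn1 mulSn addnC subnDA.
  exact: steps_le (steps_block _ _ _ _).
have rN : block_regs inp (fun=> false) size_ops (A M) = env run_params 0 0 0 0 0 0 0 0 0 counters0.
  by rewrite /A /env /= (eqP (_ : a - M * d == 0)) // subn_eq0.
apply: (steps_seq (e2 := env run_params 0 0 0 0 0 0 0 0 0 counters0) (gs2 := [::])).
  rewrite -rN; apply: steps_le; last exact: steps_block.
  apply: block_cost_maxP; rewrite /= (eqP (_ : a - M * d == 0)) ?subn_eq0 //.
  by do ![apply/andP; split] => //; lia.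
have idf b (c : counters) l : foldl (qubit_step run_params mask (fun _ _ _ c => c) b) c l = c.
  by elim: l.
have idf' (c : counters) l : foldl (block_step run_params mask (fun _ _ _ c => c) id) c l = c.
  by elim: l c => //= b l IH c; rewrite IH /block_step idf.
have := @steps_sweep inp (fun=> false) run_params mask inp_mask emit_pair (fun _ _ _ c => c)
  pair_gates 10 _ _ _ _ [::] id 1 _ _ _ _ 0 0 counters0 [::].
rewrite idf' => H; apply: steps_le (H _ _ _ _ _ _ _ _) => //.
  rewrite leq_add2l ltnS /=; apply: leq_mul; first lia.
  by rewrite leq_add2r leq_add2r leq_mul.
Qed.

Lemma holds_config0 : holds_regs config0 (nseq nregs 0) [::].
Proof. by split=> // x xS; rewrite nth_nseq if_same. Qed.

Section Decide.
Variable res : nat -> bool.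

Definition pair_parity (b : nat) (h : bool) : bool :=
  \big[addb/false]_(i <- iota 0 n) \big[addb/false]_(g <- [:: false; true])
     (res (pair_src mask n b i h g) && res (pair_tgt mask n b i h g)).

Definition odd_blocks (h : bool) : nat := \sum_(b <- iota 0 N) pair_parity b h.

Lemma read_all_pairs :
  foldl (block_step run_params mask (read_counters res) close_counters) counters0 (iota 0 N)
  = Counters false false (odd_blocks false) (odd_blocks true).
Proof.
have qE b c l : foldl (qubit_step run_params mask (read_counters res) b) c l =
  Counters (parA c (+) \big[addb/false]_(i <- l) \big[addb/false]_(g <- [:: false; true])
     (res (pair_src mask n b i false g) && res (pair_tgt mask n b i false g)))
   (parB c (+) \big[addb/false]_(i <- l) \big[addb/false]_(g <- [:: false; true])
     (res (pair_src mask n b i true g) && res (pair_tgt mask n b i true g)))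
   (cntA c) (cntB c).
  elim: l c => [|i l IH] c /=; first by rewrite !big_nil !addbF; case: c.
  by rewrite IH /= !big_cons !big_nil !addbF !addbA.
have bE x y l : foldl (block_step run_params mask (read_counters res) close_counters)
    (Counters false false x y) l =
  Counters false false (x + \sum_(b <- l) pair_parity b false) (y + \sum_(b <- l) pair_parity b true).
  elim: l x y => [|b l IH] x y /=; first by rewrite !big_nil !addn0.
  by rewrite /block_step qE /close_counters /= IH !big_cons !addnA.
by rewrite bE.
Qed.

Definition decide_time : nat :=
  (10 + (V * (V * (351 + 4 * 100) + 30 + 100)).+1) + block_cost_max V verdict_ops.

Lemma steps_decide gs : exists gs' e',
  steps inp res decide_prog (env run_params 0 (8 * N * n) 0 0 0 0 0 0 0 counters0) gs
    decide_time e' gs' /\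
  let h := 2 * r * (D * D) in let g := e1 * e1 + r * e2 * D in
  let x := odd_blocks false in let y := odd_blocks true in
  size e' = nregs /\ nth 0 e' 0 = h * N + g * (y + y) + 1 - (g * N + h * (x + x)).
Proof.
have NV : N <= V by apply: leq_trans VN; rewrite leq_pmull.
have xle h : odd_blocks h <= N.
  rewrite /odd_blocks; apply: (@leq_trans (\sum_(b <- iota 0 N) 1)).
    by apply: leq_sum => b _; case: pair_parity.
  by rewrite sum1_size size_iota.
have := @steps_sweep inp res run_params mask inp_mask read_pair (read_counters res)
  (fun _ _ => [::]) 100 _ _ _ _ close_block close_counters 30 _ _ _ _ 0 (8 * N * n) counters0 gs.
rewrite read_all_pairs => H; do 2 eexists; split.
  apply: steps_seq.
  - apply: steps_le (H _ _ _ _ _ _ _ _).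
    + rewrite leq_add2l ltnS /=; apply: leq_mul => //.
      by rewrite leq_add2r leq_add2r leq_mul.
    + by case.
    + case=> cnt base i icnt m s w c t [pA pB x y]; rewrite /env /read_counters /=.
        by case: (res c) (res t) pA pB => [] [] [] [].
      by case: (res c) (res t) pA pB => [] [] [] [].
    + by case.
    + case=> cnt base i icnt m s w c t [pA pB x y] /=;
        by case: (res c) (res t) pA pB => [] [] [] [].
    + by [].
    + move=> cnt base i icnt m s w c t [pA pB x y].
      by rewrite /env /close_counters /= .
    + by [].
    + by [].
  - apply: steps_le; last exact: steps_block.
    apply: block_cost_maxP; rewrite /=.
    by do ![apply/andP; split] => //; have := xle false; have := xle true; lia.
by split=> //=.
Qed.

End Decide.
End Run.
End Programs.

Local Open Scope ring_scope.
Local Open Scope sesquilinear_scope.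

(** * Bell measurements *)

Section Entries.
Variables (R : rcfType) (T : finType).
Implicit Types M N : operator R T.

Lemma entry_opmx (f : bits T -> bits T -> R[i]) x y : entry (opmx f) x y = f x y.
Proof. by rewrite /entry mxE !enum_rankK. Qed.

Lemma entry_inj M N : (forall x y, entry M x y = entry N x y) -> M = N.
Proof.
by move=> eMN; apply/matrixP => i j; rewrite -(enum_valK i) -(enum_valK j); apply: eMN.
Qed.

Lemma sum_enum_rank (F : 'I_#|{: bits T}| -> R[i]) :
  \sum_i F i = \sum_(x : bits T) F (enum_rank x).
Proof. by rewrite (reindex (@enum_rank (bits T))) //; apply/onW_bij/enum_rank_bij. Qed.

Lemma entry_mul M N x y : entry (M *m N) x y = \sum_z entry M x z * entry N z y.
Proof. by rewrite /entry mxE sum_enum_rank. Qed.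

Lemma entry_adj M x y : entry (M^t*) x y = (entry M y x)^*.
Proof. by rewrite /entry !mxE. Qed.

Lemma trace_entry M : \tr M = \sum_x entry M x x.
Proof. by rewrite /mxtrace sum_enum_rank. Qed.

End Entries.

Section Wires.
Variable w : nat.
Implicit Types x y : bits 'I_w.

Lemma wire_ord x (i : 'I_w) : wire x i = x i.
Proof. by rewrite /wire valK. Qed.

Lemma wire_out x m : (w <= m)%N -> wire x m = false.
Proof. by move=> wm; rewrite /wire insubF // ltnNge wm. Qed.

Lemma wire_inj x y : (forall m, wire x m = wire y m) -> x = y.
Proof. by move=> exy; apply/ffunP => i; rewrite -!wire_ord. Qed.

Lemma wire_flip t b x m :
  wire (flip t b x) m = wire x m (+) [&& b, m == t & (m < w)%N].
Proof.
have [mw|wm] := ltnP m w; last by rewrite !wire_out // !andbF.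
rewrite -[m]/(val (Ordinal mw)) !wire_ord ffunE andbT /=.
by case: (m == t); rewrite ?andbT ?andbF ?addbF.
Qed.

Lemma agree_offP c x y :
  reflect (forall m, m != c -> wire x m = wire y m) (agree_off c x y).
Proof.
apply: (iffP forallP) => [H m mc|H j].
  have [mw|wm] := ltnP m w; last by rewrite !wire_out.
  by have /implyP/(_ mc)/eqP := H (Ordinal mw); rewrite -!wire_ord.
by apply/implyP => jc; rewrite -!wire_ord (H _ jc).
Qed.

Lemma agree_off_flip c b x y : agree_off c (flip c b x) y = agree_off c x y.
Proof.
by apply/agree_offP/agree_offP => H m mc; rewrite -(H m mc) wire_flip (negPf mc) /= andbF addbF.
Qed.

Lemma eq_agree_off c x y : (x == y) = agree_off c x y && (wire x c == wire y c).
Proof.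
apply/eqP/andP => [->|[/agree_offP H /eqP Hc]]; first by split=> //; apply/agree_offP.
by apply: wire_inj => m; have [->//|/H] := eqVneq m c.
Qed.

(** Flipping both bits when they differ exchanges them; written this way, each bit of the result is
    an exclusive or of bits of [x]. *)
Definition swap_if (s : bool) (c t : nat) x : bits 'I_w :=
  let b := s && (wire x c (+) wire x t) in flip c b (flip t b x).

Lemma wire_swap_if s c t x m : (c < w)%N -> (t < w)%N ->
  wire (swap_if s c t x) m =
  if s then (if m == c then wire x t else if m == t then wire x c else wire x m)
  else wire x m.
Proof.
move=> cw tw; rewrite /swap_if !wire_flip; case: s; last by rewrite !addbF.
have [->|mc] := eqVneq m c; rewrite /= ?cw ?andbF ?addbF.
  have [<-|ct] /= := eqVneq c t; rewrite ?cw ?andbT ?andbF ?addbF;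
  by case: (wire x c) (wire x t) => [] [].
have [->|mt] := eqVneq m t; rewrite /= ?tw ?andbF ?addbF ?andbT //.
by case: (wire x c) (wire x t) => [] [].
Qed.

Definition fun_indep (A : Type) (m : nat) (f : bits 'I_w -> A) : Prop :=
  forall b x, f (flip m b x) = f x.

(** Besides fixing wire m, [p] must not look at it when acting elsewhere; commuting with the flip of
    m says so. This is how disjointness of the pairs enters the conjugations. *)
Definition map_indep (m : nat) (p : bits 'I_w -> bits 'I_w) : Prop :=
  forall x, wire (p x) m = wire x m /\ forall b, p (flip m b x) = flip m b (p x).

Lemma map_indep_swap_if s c t m p : (c < w)%N -> (t < w)%N -> m != c -> m != t ->
  map_indep m p -> map_indep m (fun x => swap_if s c t (p x)).
Proof.
move=> cw tw mc mt pm x; have [pmx pmf] := pm x; split.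
  by rewrite wire_swap_if // (negPf mc) (negPf mt) if_same.
move=> b; rewrite pmf; apply: wire_inj => k; rewrite !(wire_swap_if, wire_flip) //.
rewrite ![_ == m]eq_sym (negPf mc) (negPf mt) /= !andbF !addbF.
case: s => //.
have [->|kc] := eqVneq k c; first by rewrite (negPf mc) /= andbF addbF.
by have [->|kt] := eqVneq k t; first by rewrite (negPf mt) /= andbF addbF.
Qed.

End Wires.

Section Bell.
Variables (R : rcfType) (w : nat).
Local Notation bs := (bits 'I_w).
Local Notation op := (operator R 'I_w).

(* In the Heisenberg picture a Bell measurement turns the sign (-1)^(c t), which is
   -1 on the singlet only, into the swap of wires c and t.  All intermediate
   operators are monomial matrices. *)
Definition monomial (f : bs -> R[i]) (p : bs -> bs) : op :=
  opmx (fun x y => f x * (p x == y)%:R).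

Lemma entry_conj_monomial (G : op) f p x y :
  entry (G^t* *m monomial f p *m G) x y =
  \sum_z (entry G z x)^* * f z * entry G (p z) y.
Proof.
rewrite -mulmxA entry_mul; apply: eq_bigr => z _; rewrite entry_adj -mulrA; congr (_ * _).
rewrite entry_mul (bigD1 (p z)) //= entry_opmx eqxx mulr1 big1 ?addr0 // => u upz.
by rewrite entry_opmx eq_sym (negPf upz) mulr0 mul0r.
Qed.

Lemma sum_agree_off c (x : bs) (F : bs -> R[i]) : (c < w)%N ->
  \sum_z (if agree_off c z x then F z else 0) = F x + F (flip c true x).
Proof.
move=> cw; rewrite -big_mkcond (bigD1 x) /=; last exact/agree_offP.
congr (_ + _); rewrite (bigD1 (flip c true x)) /= ?big1 ?addr0 //.
  move=> z /andP[/andP[zx nzx]] /negP[]; rewrite (eq_agree_off c).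
  move: nzx; rewrite (eq_agree_off c) zx /= wire_flip eqxx cw /=.
  move/agree_offP: zx => zx nzx; apply/andP; split; last by case: (wire z c) (wire x c) nzx => [] [].
  by apply/agree_offP => m mc; rewrite zx // wire_flip (negPf mc) addbF.
rewrite agree_off_flip; apply/andP; split; first exact/agree_offP.
by rewrite (eq_agree_off c) negb_and wire_flip eqxx cw /=; case: (wire x c); rewrite orbT.
Qed.

Lemma sqrtC2_neq0 : sqrtC (2 : R[i]) != 0.
Proof. by rewrite sqrtC_eq0 pnatr_eq0. Qed.

(** Hadamard conjugation turns Z on wire c into X. The factor (-1)^(c s) is Z applied when [s]
    holds, so it becomes a flip of c by [s]. *)
Lemma hadamard_conj c s f p : (c < w)%N -> fun_indep c f -> fun_indep c s ->
  map_indep c p ->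
  (gate_mx R w (GateH c))^t* *m
    monomial (fun x => f x * (-1) ^+ (wire x c && s x)) p *m gate_mx R w (GateH c)
  = monomial f (fun x => flip c (s x) (p x)).
Proof.
move=> cw fc sc pc; apply: entry_inj => x y.
rewrite entry_conj_monomial /= cw entry_opmx.
have sq2 : sqrtC (2 : R[i]) * sqrtC 2 = 2 by rewrite -expr2 sqrtCK.
have sc2 : (sqrtC (2 : R[i]))^* = sqrtC 2.
  by apply: CrealP; rewrite realE sqrtC_ge0 ler0n.
under eq_bigr => z _.
  rewrite !entry_opmx (fun_if (fun u => u^*)) conjC0.
  rewrite (fun_if (fun u => u * _ * _)) !mul0r.
  over.
rewrite sum_agree_off //; have [pxc pxf] := pc x.
rewrite pxf agree_off_flip fc sc !wire_flip eqxx cw /= pxc.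
rewrite (eq_agree_off c) agree_off_flip wire_flip eqxx cw pxc /= andbT.
case: (agree_off c (p x) y); last by rewrite /= !mulr0 addr0.
have H2 : (sqrtC (2 : R[i])) != 0 := sqrtC2_neq0.
rewrite !rmorphM !fmorphV !rmorphXn !rmorphN1 /= sc2.
have E k l m : (-1) ^+ (k : bool) / sqrtC 2 * (f x * (-1) ^+ (l : bool)) * ((-1) ^+ (m : bool) / sqrtC 2)
   = f x * ((-1) ^+ (k : nat) * (-1) ^+ (l : nat) * (-1) ^+ (m : nat)) / 2 :> R[i].
  by rewrite -[X in _ = _ / X]sq2 invfM; ring.
rewrite !E -mulrDl -mulrDr -mulrA; congr (_ * _).
case: (wire x c) (s x) (wire y c) => [] [] [] /=; rewrite ?expr0 ?expr1;
  by field; rewrite ?pnatr_eq0.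
Qed.

Lemma cnot_conj c t f p : c != t -> (c < w)%N ->
  let k (x : bs) := flip t (wire x c) x in
  (gate_mx R w (GateCNOT c t))^t* *m monomial f p *m gate_mx R w (GateCNOT c t)
  = monomial (fun x => f (k x)) (fun x => k (p (k x))).
Proof.
move=> ct cw k; have kk : involutive k.
  move=> x; apply: wire_inj => m; rewrite !wire_flip (negPf ct) andbF addbF.
  by rewrite -addbA addbb addbF.
apply: entry_inj => x y; rewrite entry_conj_monomial /= ct entry_opmx.
rewrite (bigD1 (k x)) //= !entry_opmx eqxx conjC1 mul1r big1 ?addr0 => [|z zk].
  by rewrite (can2_eq kk kk).
by rewrite !entry_opmx (negPf zk) conjC0 !mul0r.
Qed.

Lemma circuit_mx_cons g gs :
  circuit_mx R w (g :: gs) = circuit_mx R w gs *m gate_mx R w g.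
Proof.
rewrite /circuit_mx /= mulmx1.
elim/last_ind: gs => [|gs h IH]; first by rewrite /= mul1mx.
by rewrite -!cats1 !foldl_cat /= IH mulmxA.
Qed.

Lemma monomial_ext f f' p p' : f =1 f' -> p =1 p' -> monomial f p = monomial f' p'.
Proof. by move=> ff pp; apply: entry_inj => x y; rewrite !entry_opmx ff pp. Qed.

Lemma fun_indep_wire m k : m != k -> fun_indep m (fun x : bs => wire x k).
Proof. by move=> mk b x; rewrite wire_flip eq_sym (negPf mk) /= andbF addbF. Qed.

Lemma adj_mul (A B : op) : (A *m B)^t* = B^t* *m A^t*.
Proof. by rewrite trmx_mul map_mxM. Qed.

Lemma conj_mulmx (A B X : op) :
  (A *m B)^t* *m X *m (A *m B) = B^t* *m (A^t* *m X *m A) *m B.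
Proof. by rewrite adj_mul !mulmxA. Qed.

(** The sign is a controlled Z. Conjugation by H on c makes it a CNOT from t to c, and conjugation
    by the CNOT from c to t then gives three alternating CNOTs, which is the swap. *)
Lemma bell_pair_conj s c t f p : c != t -> (c < w)%N -> (t < w)%N ->
  fun_indep c f -> fun_indep t f -> map_indep c p -> map_indep t p ->
  let U := gate_mx R w (GateH c) *m gate_mx R w (GateCNOT c t) in
  U^t* *m monomial (fun x => f x * (if s then (-1) ^+ (wire x c && wire x t) else 1)) p *m U
  = monomial f (fun x => swap_if s c t (p x)).
Proof.
move=> ct cw tw fc ft pc pt U; have tc : t != c by rewrite eq_sym.
rewrite (@monomial_ext _ (fun x => f x * (-1) ^+ (wire x c && (s && wire x t))) p p) //; last first.
  by move=> x; case: s; rewrite ?andbF ?expr0.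
rewrite /U conj_mulmx hadamard_conj //; last by move=> b x; rewrite fun_indep_wire // eq_sym.
rewrite cnot_conj //; apply: monomial_ext => x; first by rewrite ft.
have [ptx ptf] := pt x; have [pcx pcf] := pc x.
rewrite ptf; apply: wire_inj => m.
have [pmt _] := pt (flip t (wire x c) x).
rewrite wire_swap_if // !wire_flip !eqxx ?cw ?tw (negPf ct) ?(negPf tc) ?andbF ?andbT /= !addbF ?andbT pcx.
have [->|mc] := eqVneq m c.
  rewrite (negPf ct) cw /= !andbF !andbT !addbF pcx ptx.
  by case: s (wire x c) (wire x t) => [] [] [].
have [->|mt] := eqVneq m t; rewrite /= ?andbF ?addbF ?if_same //.
rewrite tw ptx !andbT.
by case: s (wire x c) (wire x t) => [] [] [].
Qed.

Variables (I : Type) (c t : I -> nat) (s : I -> bool).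

Definition wires_of (L : seq I) : seq nat := flatten [seq [:: c q; t q] | q <- L].
Definition bell_circuit (L : seq I) : seq gate :=
  flatten [seq [:: GateCNOT (c q) (t q); GateH (c q)] | q <- L].
Definition singlet_sign (L : seq I) (x : bs) : R[i] :=
  \prod_(q <- L | s q) (-1) ^+ (wire x (c q) && wire x (t q)).
Definition swap_all (L : seq I) (x : bs) : bs :=
  foldr (fun q y => swap_if (s q) (c q) (t q) y) x L.

Lemma map_indep_swap_all L m p : all (fun k => (k < w)%N) (wires_of L) ->
  m \notin wires_of L -> map_indep m p -> map_indep m (fun x => swap_all L (p x)).
Proof.
elim: L => [|q L IH] //= /and3P[cw tw Lw].
rewrite !inE !negb_or => /and3P[mc mt mL] pm.
by apply: map_indep_swap_if => //; apply: IH.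
Qed.

Lemma bell_circuit_conj L f p :
  uniq (wires_of L) -> all (fun k => (k < w)%N) (wires_of L) ->
  (forall m, m \in wires_of L -> fun_indep m f /\ map_indep m p) ->
  let U := circuit_mx R w (bell_circuit L) in
  U^t* *m monomial (fun x => f x * singlet_sign L x) p *m U
  = monomial f (fun x => swap_all L (p x)).
Proof.
elim: L f p => [|q L IH] f p /=.
  move=> _ _ _; rewrite /circuit_mx /= mulmx1 trmx1 map_mx1 mul1mx.
  by apply: monomial_ext => x //; rewrite /singlet_sign big_nil mulr1.
rewrite inE negb_or => /and3P[/andP[ct cL] tL uL] /and3P[cw tw Lw] ind.
have [fc pc] : fun_indep (c q) f /\ map_indep (c q) p by apply: ind; rewrite inE eqxx.
have [ft pt] : fun_indep (t q) f /\ map_indep (t q) p.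
  by apply: ind; rewrite !inE eqxx orbT.
pose g (x : bs) := if s q then (-1) ^+ (wire x (c q) && wire x (t q)) else 1 : R[i].
rewrite !circuit_mx_cons -[_ *m gate_mx _ _ _ *m gate_mx _ _ _]mulmxA.
set U := circuit_mx R w (bell_circuit L); set V := _ *m gate_mx _ _ _.
rewrite conj_mulmx.
rewrite (@monomial_ext _ (fun x => (f x * g x) * singlet_sign L x) p p) //; last first.
  by move=> x; rewrite /singlet_sign big_cons -/(g x) /g; case: (s q); rewrite ?mulrA ?mulr1.
rewrite IH // => [|m mL]; last first.
  have [fm pm] : fun_indep m f /\ map_indep m p by apply: ind; rewrite !inE mL !orbT.
  have mc : m != c q by apply: contraNneq cL => <-.
  have mt : m != t q by apply: contraNneq tL => <-.
  by split=> // b x; rewrite fm /g !fun_indep_wire.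
rewrite bell_pair_conj //; exact: map_indep_swap_all.
Qed.

(** Membership of [q] is expressed by an index because [I] is a bare type without decidable
    equality. *)
Lemma wire_swap_all L x q : uniq (wires_of L) -> all (fun k => (k < w)%N) (wires_of L) ->
  (exists2 i, (i < size L)%N & nth q L i = q) ->
  wire (swap_all L x) (c q) = (if s q then wire x (t q) else wire x (c q)) /\
  wire (swap_all L x) (t q) = (if s q then wire x (c q) else wire x (t q)).
Proof.
have out L' m : all (fun k => (k < w)%N) (wires_of L') -> m \notin wires_of L' ->
    wire (swap_all L' x) m = wire x m.
  move=> Lw mL; have id_ind : map_indep m (fun x : bs => x) by [].
  by have [] := map_indep_swap_all Lw mL id_ind x.
elim: L => [|q' L IH] /=; first by move=> _ _ [].
rewrite inE negb_or => /and3P[/andP[ct cL] tL uL] /and3P[cw tw Lw] [[|i] iL qL].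
  move: qL => /= qL; rewrite {q'}qL in ct cL tL cw tw *.
  by rewrite !wire_swap_if // !eqxx eq_sym (negPf ct) !out.
have qin : (c q \in wires_of L) && (t q \in wires_of L).
  move: iL qL; rewrite ltnS /= => iL <-; rewrite /wires_of.
  elim: L i iL {IH cL tL uL Lw} => [|q1 L IH] [|i] //= iL; rewrite ?inE ?eqxx ?orbT //.
  by have /andP[-> ->] := IH _ iL; rewrite !orbT.
have [|H1 H2] := IH uL Lw; first by exists i.
move/andP: qin => [qc qt].
have nc m : m \in wires_of L -> (m == c q') = false by move=> mL; apply: contraNF cL => /eqP <-.
have nt m : m \in wires_of L -> (m == t q') = false by move=> mL; apply: contraNF tL => /eqP <-.
by rewrite !wire_swap_if // !nc // !nt // !if_same.
Qed.

(** Cyclicity of the trace moves the circuit onto the observable. All pairs are measured but only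
    the signs selected by [s] are multiplied, so a single circuit gives every joint moment. *)
Lemma bell_expectation L (M : op) (U := circuit_mx R w (bell_circuit L)) :
  uniq (wires_of L) -> all (fun k => (k < w)%N) (wires_of L) ->
  \sum_z singlet_sign L z * entry (U *m M *m U^t*) z z = \sum_x entry M (swap_all L x) x.
Proof.
move=> uL Lw.
have := @bell_circuit_conj L (fun=> 1) id uL Lw
  (fun m _ => conj (fun _ _ => erefl) (fun x => conj erefl (fun _ => erefl))).
rewrite -/U => /(congr1 (fun X => \tr (X *m M))).
rewrite -!mulmxA mxtrace_mulC -!mulmxA => E.
transitivity (\tr (monomial (fun x => 1 * singlet_sign L x) id *m (U *m (M *m U^t*)))).
  rewrite trace_entry; apply: eq_bigr => z _; rewrite [RHS]entry_mul (bigD1 z) //=.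
  rewrite entry_opmx eqxx mulr1 mul1r !mulmxA big1 ?addr0 // => y yz.
  by rewrite entry_opmx eq_sym (negPf yz) mulr0 mul0r.
rewrite E trace_entry; apply: eq_bigr => x _.
rewrite entry_mul (bigD1 (swap_all L x)) //= entry_opmx eqxx !mul1r big1 ?addr0 // => y yx.
by rewrite entry_opmx eq_sym (negPf yx) mulr0 mul0r.
Qed.

End Bell.

(** * Wire layout and block expectations *)

Lemma wire_noP N n m : (m < 8 * N * n)%N ->
  exists b h al be i, [/\ (b < N)%N, (i < n)%N & m = wire_no n b h al be i].
Proof.
move=> mlt; have n0 : (0 < n)%N by case: n mlt => //; rewrite muln0.
have jlt : (m %/ n < 8 * N)%N by rewrite ltn_divLR.
set j := (m %/ n)%N in jlt.
exists (j %/ 8)%N, (odd (j %/ 4)), (odd (j %/ 2)), (odd j), (m %% n)%N; split.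
- by rewrite ltn_divLR // mulnC.
- by rewrite ltn_pmod.
- rewrite /wire_no [LHS](divn_eq m n) -/j; congr (_ * n + _)%N.
  lia.
Qed.

Lemma wire_no_lt N n b h al be i : (b < N)%N -> (i < n)%N ->
  (wire_no n b h al be i < 8 * N * n)%N.
Proof.
move=> bN iN; rewrite /wire_no.
have : (8 * b + 4 * h + 2 * al + be < 8 * N)%N by case: h al be => [] [] []; lia.
set j := (_ + be)%N => jN; have : (j.+1 * n <= 8 * N * n)%N by rewrite leq_mul2r jN orbT.
by lia.
Qed.

Section Layout.
Variables (n N : nat) (mask : nat -> bool).

Definition pair_index : Type := (nat * nat * (bool * bool))%type.

Definition pair_list : seq pair_index :=
  flatten [seq flatten [seq [seq (b, i, g) | g <- halves] | i <- iota 0 n] | b <- iota 0 N].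

Definition src (q : pair_index) := pair_src mask n q.1.1 q.1.2 q.2.1 q.2.2.
Definition tgt (q : pair_index) := pair_tgt mask n q.1.1 q.1.2 q.2.1 q.2.2.

Lemma mem_pair_list b i g : (b, i, g) \in pair_list = (b < N)%N && (i < n)%N.
Proof.
apply/flatten_mapP/andP => [[b' + /flatten_mapP[i' + /mapP[g' _ [-> -> _]]]]|[bN iN]].
  by rewrite !mem_iota.
exists b; first by rewrite mem_iota.
apply/flatten_mapP; exists i; first by rewrite mem_iota.
by apply/mapP; exists g => //; case: g => [] [] [].
Qed.

Lemma sweep_gates_bell F : pn F = n ->
  sweep_gates F mask pair_gates N = bell_circuit src tgt pair_list.
Proof.
move=> Fn; rewrite /sweep_gates /bell_circuit /pair_list Fn.
elim: (iota 0 N) => //= b l ->; rewrite map_cat flatten_cat; congr (_ ++ _).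
elim: (iota 0 n) => //= i l' ->; rewrite /qubit_gates /src /tgt /= Fn.
done.
Qed.

Lemma size_wires_of (I : Type) (c t : I -> nat) L : size (wires_of c t L) = (2 * size L)%N.
Proof. by elim: L => //= q L ->; rewrite mulnS. Qed.

Lemma size_pair_list : size pair_list = (4 * N * n)%N.
Proof.
rewrite -[in RHS](size_iota 0 N) /pair_list.
elim: (iota 0 N) => [|b l IH] /=; first by rewrite muln0 mul0n.
rewrite size_cat IH mulnS mulnDl; congr (_ + _)%N.
by rewrite -[in RHS](size_iota 0 n); elim: (iota 0 n) => //= i l' ->; rewrite mulnS.
Qed.

Lemma all_wires_lt : all (fun k => (k < 8 * N * n)%N) (wires_of src tgt pair_list).
Proof.
apply/allP => m /flatten_mapP[[[b i] g]]; rewrite mem_pair_list => /andP[bN iN].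
rewrite !inE /src /tgt /pair_src /pair_tgt /=.
by case/orP => /eqP ->; case: ifP => _; apply: wire_no_lt.
Qed.

Lemma wires_cover m : (m < 8 * N * n)%N -> m \in wires_of src tgt pair_list.
Proof.
case/wire_noP => b [h [al [be [i [bN iN ->]]]]].
pose mk := ~~ h && mask i.
apply/flatten_mapP; exists (b, i, (h, if mk then be else al)).
  by rewrite mem_pair_list bN.
rewrite !inE /src /tgt /pair_src /pair_tgt /= -/mk.
by case: mk; case: al be => [] []; rewrite eqxx ?orbT.
Qed.

(** By counting: the list has 8Nn entries and contains each of the 8Nn wires, so it has no
    repetition. *)
Lemma uniq_wires : uniq (wires_of src tgt pair_list).
Proof.
apply: (@leq_size_uniq _ (iota 0 (8 * N * n))); first exact: iota_uniq.
  by move=> m; rewrite mem_iota => /= /wires_cover.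
by rewrite size_iota size_wires_of size_pair_list; lia.
Qed.

Lemma wire_swap_quad w (S : nat -> bool -> bool) (x : bits 'I_w) b h al be i :
  (8 * N * n <= w)%N -> (b < N)%N -> (i < n)%N ->
  let mk := ~~ h && mask i in
  wire (swap_all src tgt (fun q => S q.1.1 q.2.1) pair_list x) (wire_no n b h al be i) =
  if S b h then wire x (wire_no n b h (al (+) mk) (be (+) ~~ mk) i)
  else wire x (wire_no n b h al be i).
Proof.
move=> wlt bN iN mk.
have lt_w : all (fun k => (k < w)%N) (wires_of src tgt pair_list).
  by apply: sub_all all_wires_lt => k /leq_trans; apply.
pose q := (b, i, (h, if mk then be else al)).
have [|] := @wire_swap_all w _ src tgt (fun q => S q.1.1 q.2.1) pair_list x q uniq_wires lt_w.
  have qL : q \in pair_list by rewrite mem_pair_list bN.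
  by exists (index q pair_list); rewrite ?index_mem ?nth_index.
move: (swap_all _ _ _ _ _) => y; rewrite /src /tgt /pair_src /pair_tgt /= -/mk.
by rewrite /q; case: mk {q}; case: al be => [] [] /= H1 H2; rewrite ?H1 ?H2.
Qed.

End Layout.

Section Expectation.
Variables (R : rcfType) (n N : nat) (mask : nat -> bool) (rho : operator R 'I_n).
Local Notation w := (8 * N * n + 0)%N.
Local Notation slot := (bool * bool)%type.
Local Notation quadbits := {ffun slot -> bits 'I_n}.

Definition swap_quad (mk : nat -> bool) (y : quadbits) (ab : slot) : bits 'I_n :=
  [ffun i : 'I_n => y (ab.1 (+) mk i, ab.2 (+) ~~ mk i) i].

(* The trace of [rho]^{(x)4} times the product of swaps that pairs the four copies
   along the first label on masked qubits and along the second label elsewhere. *)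
Definition quad_value (mk : nat -> bool) : R[i] :=
  \sum_(y : quadbits) \prod_(ab : slot) entry rho (swap_quad mk y ab) (y ab).

Definition half_mask (h : bool) (i : nat) : bool := ~~ h && mask i.

Definition copy_no (p : ('I_N * bool) * slot) : nat :=
  (8 * p.1.1 + 4 * p.1.2 + 2 * p.2.1 + p.2.2)%N.

Lemma copy_no_lt p : (copy_no p < 8 * N)%N.
Proof. by case: p => [[b h] [al be]]; rewrite /copy_no /=; have := ltn_ord b; case: h al be => [] [] []; lia. Qed.

Definition copy_ord p : 'I_(8 * N) := Ordinal (copy_no_lt p).

Lemma copy_ord_bij : bijective copy_ord.
Proof.
apply: inj_card_bij; last by rewrite !card_prod !card_bool !card_ord; lia.
move=> [[b h] [al be]] [[b' h'] [al' be']] /(congr1 val); rewrite /= /copy_no /= => E.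
have half (x x' : nat) (c c' : bool) : (2 * x + c = 2 * x' + c')%N -> x = x' /\ c = c'.
  by case: c c' => [] [] /= ?; split=> //; lia.
have bin (x y z t : nat) : (8 * x + 4 * y + 2 * z + t = 2 * (2 * (2 * x + y) + z) + t)%N by lia.
move: E; rewrite !bin.
move=> /half[/half[/half[bb <-] <-] <-].
by rewrite (_ : b = b') //; apply: val_inj.
Qed.

(** Regroups a basis label by half rounds. No swap crosses a half round, so sums over labels factor
    along this bijection. *)
Definition split_copies (x : bits 'I_w) : {ffun 'I_N * bool -> quadbits} :=
  [ffun bh : 'I_N * bool => [ffun ab : slot => [ffun i : 'I_n => wire x (wire_no n bh.1 bh.2 ab.1 ab.2 i)]]].

Lemma split_copies_bij : bijective split_copies.
Proof.
apply: inj_card_bij => [x y E|]; last first.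
  rewrite !card_ffun !card_prod !card_bool !card_ord.
  rewrite -(expnM 2 n) -(expnM 2) (_ : (n * (2 * 2) * (N * 2) = 8 * N * n + 0)%N) //.
  by move: (n) (N) => n' N'; lia.
apply: wire_inj => m; have [mw|wm] := ltnP m w; last by rewrite !wire_out.
rewrite addn0 in mw; have [b [h [al [be [i [bN iN ->]]]]]] := wire_noP mw.
move/ffunP/(_ (Ordinal bN, h)): E; rewrite !ffunE => /ffunP/(_ (al, be)).
by rewrite !ffunE => /ffunP/(_ (Ordinal iN)); rewrite !ffunE.
Qed.

Lemma prod_copies (f : nat -> R[i]) :
  \prod_(j < 8 * N) f j = \prod_(bh : 'I_N * bool) \prod_(ab : slot) f (copy_no (bh, ab)).
Proof.
rewrite pair_bigA /= (reindex copy_ord); last exact/onW_bij/copy_ord_bij.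
by apply: eq_bigr => -[bh ab].
Qed.

Lemma entry_input_state x y :
  entry (input_state (8 * N) 0 rho) x y =
  \prod_(bh : 'I_N * bool) \prod_(ab : slot)
     entry rho (split_copies x bh ab) (split_copies y bh ab).
Proof.
have anc (z : bits 'I_w) : [forall m : 'I_0, ~~ wire z (8 * N * n + m)] = true.
  by apply/forallP => -[].
rewrite /input_state entry_opmx !anc.
rewrite (@prod_copies (fun j => entry rho [ffun i : 'I_n => wire x (j * n + i)]
  [ffun i : 'I_n => wire y (j * n + i)])).
apply: eq_bigr => bh _; apply: eq_bigr => ab _.
by rewrite !ffunE.
Qed.

Lemma sum_split (F : 'I_N * bool -> quadbits -> R[i]) :
  \sum_x \prod_bh F bh (split_copies x bh) = \prod_bh \sum_y F bh y.
Proof.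
rewrite bigA_distr_bigA /= [RHS](reindex split_copies) //.
exact/onW_bij/split_copies_bij.
Qed.

Lemma trace_quad : \sum_(y : quadbits) \prod_(ab : slot) entry rho (y ab) (y ab) = \tr rho ^+ 4.
Proof.
rewrite trace_entry -(bigA_distr_bigA (fun (ab : slot) u => entry rho u u)).
by rewrite prodr_const card_prod card_bool.
Qed.

(** The trace factors over half rounds: a selected one gives its [quad_value], an unselected one
    gives (tr rho)^4 = 1. *)
Lemma sum_swap_quads (S : nat -> bool -> bool) : \tr rho = 1 ->
  \sum_x entry (input_state (8 * N) 0 rho)
     (swap_all (src n mask) (tgt n mask) (fun q => S q.1.1 q.2.1) (pair_list n N) x) x
  = \prod_(bh : 'I_N * bool) (if S bh.1 bh.2 then quad_value (half_mask bh.2) else 1).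
Proof.
move=> tr1; pose F (bh : 'I_N * bool) (y : quadbits) := \prod_(ab : slot)
   entry rho (if S bh.1 bh.2 then swap_quad (half_mask bh.2) y ab else y ab) (y ab).
transitivity (\sum_x \prod_bh F bh (split_copies x bh)).
  apply: eq_bigr => x _; rewrite entry_input_state; apply: eq_bigr => bh _.
  apply: eq_bigr => ab _; congr (entry rho _ _).
  apply/ffunP => i; rewrite ffunE ffunE ffunE wire_swap_quad ?addn0 //.
  by case: (S _ _); rewrite !ffunE.
rewrite sum_split; apply: eq_bigr => bh _; rewrite /F.
by case: (S _ _) => //; rewrite trace_quad tr1 expr1n.
Qed.

Definition block_sign (z : nat -> bool) (b : nat) (h : bool) : R[i] :=
  (-1) ^+ pair_parity mask n z b h.

Lemma sign_big_addb (I : Type) (l : seq I) (f : I -> bool) :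
  (-1) ^+ (\big[addb/false]_(i <- l) f i) = \prod_(i <- l) (-1) ^+ (f i) :> R[i].
Proof.
elim: l => [|i l IH]; first by rewrite !big_nil.
by rewrite !big_cons signr_addb IH.
Qed.

Lemma singlet_signE (S : nat -> bool -> bool) w (z : bits 'I_w) :
  singlet_sign R (src n mask) (tgt n mask) (fun q => S q.1.1 q.2.1) (pair_list n N) z
  = \prod_(bh : 'I_N * bool) (if S bh.1 bh.2 then block_sign (wire z) bh.1 bh.2 else 1).
Proof.
rewrite /singlet_sign big_flatten big_map /=.
rewrite -(pair_bigA _ (fun (b : 'I_N) h => if S b h then block_sign (wire z) b h else 1)) /=.
rewrite (_ : iota 0 N = index_iota 0 N) ?big_mkord; last by rewrite /index_iota subn0.
apply: eq_bigr => b _.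
pose u h i : R[i] := \prod_(g <- [:: false; true])
  (-1) ^+ (wire z (pair_src mask n b i h g) && wire z (pair_tgt mask n b i h g)).
have signE h : block_sign (wire z) b h = \prod_(i <- iota 0 n) u h i.
  by rewrite /block_sign sign_big_addb; apply: eq_bigr => i _; rewrite sign_big_addb.
rewrite big_flatten big_map big_bool /= !signE.
have if1 (s : bool) h : (if s then \prod_(i <- iota 0 n) u h i else 1)
    = \prod_(i <- iota 0 n) if s then u h i else 1.
  by case: s => //; rewrite big1_eq.
rewrite !if1 -big_split /=; apply: eq_bigr => i _.
rewrite /u !big_cons !big_nil /= /src /tgt /=.
by case: (S b true) (S b false) => [] [] /=; ring.
Qed.

(** The product form for every selection [S] makes the signs of distinct half rounds
    uncorrelated. *)
Lemma sign_expectation (S : nat -> bool -> bool) gs : \tr rho = 1 ->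
  gs = bell_circuit (src n mask) (tgt n mask) (pair_list n N) ->
  let U := circuit_mx R w gs in
  \sum_z (\prod_(bh : 'I_N * bool) (if S bh.1 bh.2 then block_sign (wire z) bh.1 bh.2 else 1))
      * entry (U *m input_state (8 * N) 0 rho *m U^t*) z z
  = \prod_(bh : 'I_N * bool) (if S bh.1 bh.2 then quad_value (half_mask bh.2) else 1).
Proof.
move=> tr1 -> U; rewrite -sum_swap_quads //.
under eq_bigr do rewrite -singlet_signE.
apply: bell_expectation; first exact: uniq_wires.
by rewrite addn0 all_wires_lt.
Qed.

End Expectation.

(** * Operator Schmidt coefficients *)

Section FiniteSums.
Variable C : numClosedFieldType.

Definition dot (I : finType) (f g : I -> C) : C := \sum_i (f i)^* * g i.
Definition sqnorm (I : finType) (f : I -> C) : C := \sum_i `|f i| ^+ 2.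

Lemma sqnorm_ge0 (I : finType) (f : I -> C) : 0 <= sqnorm f.
Proof. by apply: sumr_ge0 => i _; rewrite exprn_ge0. Qed.

Lemma dot_self (I : finType) (f : I -> C) : dot f f = sqnorm f.
Proof. by apply: eq_bigr => i _; rewrite mulrC normCK. Qed.

Lemma conj_dot (I : finType) (f g : I -> C) : (dot f g)^* = dot g f.
Proof. by rewrite rmorph_sum; apply: eq_bigr => i _; rewrite rmorphM /= conjCK mulrC. Qed.

Lemma cauchy_schwarz (I : finType) (f g : I -> C) :
  `|dot f g| ^+ 2 <= sqnorm f * sqnorm g.
Proof.
have [f0|fn0] := eqVneq (sqnorm f) 0.
  rewrite f0 mul0r /dot big1 ?normr0 ?expr0n // => i _.
  have /psumr_eq0P := f0 => /(_ (fun i _ => exprn_ge0 2 (normr_ge0 (f i)))) /(_ i isT) /eqP.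
  by rewrite expf_eq0 /= normr_eq0 => /eqP ->; rewrite conjC0 mul0r.
have fp : 0 < sqnorm f by rewrite lt_def fn0 sqnorm_ge0.
set F := sqnorm f; set z := dot f g.
have : 0 <= \sum_i `|F * g i - z * f i| ^+ 2 by apply: sumr_ge0 => i _; rewrite exprn_ge0.
have FC : F^* = F by apply: CrealP; exact: ger0_real (ltW fp).
have -> : \sum_i `|F * g i - z * f i| ^+ 2 = F * (F * sqnorm g - `|z| ^+ 2).
  transitivity (F * F * dot g g - z * F * dot g f - z^* * F * dot f g + z * z^* * dot f f).
    rewrite /dot; move: (F) (z) FC => F' z' FC.
    rewrite !mulr_sumr -!sumrB -big_split /=; apply: eq_bigr => i _.
    by rewrite normCK rmorphB !rmorphM /= FC; ring.
  by rewrite -/z -(conj_dot f g) -/z !dot_self -/F normCK; ring.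
by rewrite pmulr_rge0 // subr_ge0.
Qed.

Definition orthonormal_family (J I : finType) (a : J -> I -> C) : Prop :=
  forall i j, dot (a i) (a j) = (i == j)%:R.

Lemma orthonormal_sqnorm (J I : finType) (a : J -> I -> C) i :
  orthonormal_family a -> sqnorm (a i) = 1.
Proof. by move=> aO; rewrite -dot_self aO eqxx. Qed.

Lemma bessel (J I : finType) (a : J -> I -> C) (f : I -> C) :
  orthonormal_family a -> \sum_j `|dot (a j) f| ^+ 2 <= sqnorm f.
Proof.
move=> aO; pose p i := \sum_j dot (a j) f * a j i.
have pf : dot p f = \sum_j `|dot (a j) f| ^+ 2.
  rewrite /dot; under eq_bigr => i _ do rewrite rmorph_sum mulr_suml.
  rewrite exchange_big /=; apply: eq_bigr => j _; rewrite normCK -/(dot _ _) mulrC -/(dot _ _).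
  rewrite [in RHS]/dot mulr_sumr.
  by apply: eq_bigr => i _; rewrite rmorphM mulrA.
have pp : dot p p = \sum_j `|dot (a j) f| ^+ 2.
  rewrite -pf /dot.
  transitivity (\sum_j dot (a j) f * dot p (a j)).
    under eq_bigr => i _ do rewrite [X in _ * X]/p mulr_sumr.
    rewrite exchange_big; apply: eq_bigr => j _; rewrite [X in _ = _ * X]/dot mulr_sumr.
    by apply: eq_bigr => i _; rewrite mulrCA.
  have pa j : dot p (a j) = (dot (a j) f)^*.
    rewrite -[LHS]conjCK conj_dot; congr (_^*).
    rewrite /dot /p; under eq_bigr => i _ do rewrite mulr_sumr.
    rewrite exchange_big (bigD1 j) //= [X in _ + X]big1 ?addr0 => [|k kj].
      transitivity (dot (a j) f * dot (a j) (a j)); last by rewrite aO eqxx mulr1.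
      by rewrite [in RHS]/dot mulr_sumr; apply: eq_bigr => i _; rewrite mulrCA.
    transitivity (dot (a k) f * dot (a j) (a k)); last by rewrite aO eq_sym (negPf kj) mulr0.
    by rewrite [in RHS]/dot mulr_sumr; apply: eq_bigr => i _; rewrite mulrCA.
  by rewrite -/(dot p f) pf; apply: eq_bigr => j _; rewrite pa normCK.
have : 0 <= sqnorm (fun i => f i - p i) by apply: sqnorm_ge0.
have -> : sqnorm (fun i => f i - p i) = dot f f - dot f p - dot p f + dot p p.
  rewrite -dot_self /dot -!sumrB -big_split; apply: eq_bigr => i _ /=.
  by rewrite rmorphB; ring.
rewrite -(conj_dot p f) pp pf dot_self.
have -> : (\sum_j `|dot (a j) f| ^+ 2)^* = \sum_j `|dot (a j) f| ^+ 2.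
  by apply: CrealP; apply: ger0_real; apply: sumr_ge0 => j _; rewrite exprn_ge0.
by rewrite -addrA addNr addr0 subr_ge0.
Qed.

Variables (U V : finType) (T : U -> V -> C).

Definition pairing (a : U -> C) (b : V -> C) : C :=
  \sum_u \sum_v (a u)^* * (b v)^* * T u v.
Definition gram_entry (u0 u1 : U) : C := \sum_v (T u0 v)^* * T u1 v.
(* The squared Hilbert-Schmidt norm of [T T^*], up to conjugation. *)
Definition gram_norm : C := \sum_u0 \sum_u1 `|gram_entry u0 u1| ^+ 2.
Definition frob_norm : C := \sum_u \sum_v `|T u v| ^+ 2.

Lemma gram_norm_ge0 : 0 <= gram_norm.
Proof. by apply: sumr_ge0 => u _; apply: sumr_ge0 => v _; rewrite exprn_ge0. Qed.

Lemma pairing_dotl a b : pairing a b = dot b (fun v => \sum_u (a u)^* * T u v).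
Proof.
rewrite /pairing exchange_big; apply: eq_bigr => v _; rewrite mulr_sumr.
by apply: eq_bigr => u _; ring.
Qed.

Lemma pairing_dotr a b : pairing a b = dot a (fun u => \sum_v (b v)^* * T u v).
Proof.
apply: eq_bigr => u _; rewrite mulr_sumr.
by apply: eq_bigr => v _; ring.
Qed.

(** Two uses of Cauchy-Schwarz: against the unit vector b, the pairing is at most the norm of g,
    which is T contracted with a; then the squared norm of g is the quadratic form of T T^* at a, at
    most the norm of T T^* a. The fourth power leaves a sum over rows to which Bessel applies. *)
Lemma pairing_norm4_le a b : sqnorm a = 1 -> sqnorm b = 1 ->
  `|pairing a b| ^+ 4 <= \sum_u `|dot a (gram_entry u)| ^+ 2.
Proof.
move=> a1 b1; pose g v := \sum_u (a u)^* * T u v.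
have le1 : `|pairing a b| ^+ 2 <= sqnorm g.
  by rewrite pairing_dotl; apply: le_trans (cauchy_schwarz _ _) _; rewrite b1 mul1r.
have gE : sqnorm g = dot (fun u => (a u)^*) (fun u => dot a (gram_entry u)).
  rewrite -dot_self /dot; under eq_bigr => v _ do rewrite /g rmorph_sum mulr_suml.
  rewrite exchange_big; apply: eq_bigr => u _ /=; rewrite conjCK.
  under eq_bigr => v _ do rewrite mulr_sumr.
  rewrite exchange_big mulr_sumr; apply: eq_bigr => u1 _.
  rewrite /gram_entry !mulr_sumr; apply: eq_bigr => v _.
  by rewrite rmorphM /= conjCK; ring.
have ac : sqnorm (fun u => (a u)^*) = 1.
  by rewrite -a1; apply: eq_bigr => u _; rewrite norm_conjC.
rewrite (exprM _ 2 2); apply: (@le_trans _ _ (sqnorm g ^+ 2)).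
  by rewrite ler_pXn2r // nnegrE ?exprn_ge0 ?sqnorm_ge0.
rewrite -[sqnorm g]ger0_norm ?sqnorm_ge0 // gE.
by apply: le_trans (cauchy_schwarz _ _) _; rewrite ac mul1r.
Qed.

(** With c_i the pairings on the support of [mu], |sum|^2 <= sum |c_i|^2 because [mu] is a unit
    vector, and the square of the latter is at most r sum |c_i|^4. Each |c_i|^4 is bounded by the
    previous lemma, and Bessel over i, row by row, sums these bounds to [gram_norm]. *)
Lemma schmidt_overlap_le (J : finType) (a : J -> U -> C) (b : J -> V -> C)
    (mu : J -> C) (r : nat) :
  orthonormal_family a -> orthonormal_family b -> sqnorm mu = 1 -> (#|[set i | mu i != 0%R]| <= r)%N ->
  `|\sum_i (mu i)^* * pairing (a i) (b i)| ^+ 4 <= r%:R * gram_norm.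
Proof.
move=> aO bO mu1 Sr; pose c i := pairing (a i) (b i).
pose S := [set i | mu i != 0]; pose cS i := if i \in S then c i else 0.
have -> : \sum_i (mu i)^* * pairing (a i) (b i) = dot mu cS.
  apply: eq_bigr => i _; rewrite /cS inE; case: eqP => [->|//].
  by rewrite conjC0 !mul0r.
have le1 : `|dot mu cS| ^+ 2 <= sqnorm cS.
  by apply: le_trans (cauchy_schwarz _ _) _; rewrite mu1 mul1r.
rewrite (exprM _ 2 2); apply: (@le_trans _ _ (sqnorm cS ^+ 2)).
  by rewrite ler_pXn2r // nnegrE ?exprn_ge0 ?sqnorm_ge0.
(* Pairing with the indicator of [S] prepares the second Cauchy-Schwarz, whose factor #|S| is the
   source of r. *)
have -> : sqnorm cS = dot (fun i => (i \in S)%:R) (fun i => `|cS i| ^+ 2).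
  apply: eq_bigr => i _; rewrite /cS; case: (i \in S); rewrite ?conjC1 ?mul1r //.
  by rewrite normr0 expr0n mulr0.
set z := dot _ _.
have z0 : 0 <= z.
  by apply: sumr_ge0 => i _; rewrite conjC_nat mulr_ge0 ?ler0n ?exprn_ge0.
rewrite -(ger0_norm z0); apply: le_trans (cauchy_schwarz _ _) _.
apply: ler_pM; rewrite ?sqnorm_ge0 //.
  rewrite /sqnorm (eq_bigr (fun i => (i \in S)%:R)) => [|i _]; last first.
    by case: (i \in S); rewrite ?normr1 ?normr0 ?expr1n ?expr0n.
  by rewrite -natr_sum -big_mkcond /= sum1_card ler_nat.
rewrite /gram_norm.
apply: (@le_trans _ _ (\sum_i \sum_u `|dot (a i) (gram_entry u)| ^+ 2)).
  apply: ler_sum => i _; rewrite /cS; case: (i \in S); last first.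
    by rewrite normr0 !expr0n normr0 expr0n; apply: sumr_ge0 => u _; rewrite exprn_ge0.
  rewrite ger0_norm ?exprn_ge0 // -exprM.
  by apply: pairing_norm4_le; apply: orthonormal_sqnorm.
rewrite exchange_big; apply: ler_sum => u _.
exact: bessel.
Qed.

(* Testing the bound on [a] = the image of [b] controls the operator norm of [T]
   without a singular value decomposition. *)
Lemma gram_norm_le (k : C) : 0 <= k ->
  (forall a b, `|pairing a b| ^+ 2 <= k * (sqnorm a * sqnorm b)) ->
  gram_norm <= k * frob_norm.
Proof.
move=> k0 bound.
have bound1 b : sqnorm (fun u => \sum_v (b v)^* * T u v) <= k * sqnorm b.
  set h := fun u => _; have := bound h b.
  rewrite pairing_dotr -/h dot_self ger0_norm ?sqnorm_ge0 // expr2.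
  have [->|hn0] := eqVneq (sqnorm h) 0; first by rewrite mulr_ge0 ?sqnorm_ge0.
  rewrite mulrCA ler_pM2l //.
  by rewrite lt_def hn0 sqnorm_ge0.
(* The part of [gram_norm] with first index u is the squared norm of the image of row u of [T], so
   [bound1] applies with that row as [b]. *)
rewrite /frob_norm mulr_sumr; apply: ler_sum => u _.
exact: bound1.
Qed.

End FiniteSums.

(** * Positivity through Gram representations *)

Section Gram.
Variable R : rcfType.

(** A sum of unnormalised pure states. Unlike the quadratic form in [is_state], this description
    passes directly to tensor powers, which gives nonnegative outcome probabilities. *)
Definition is_gram (T : finType) (M : operator R T) : Prop :=
  exists (J : finType) (f : J -> bits T -> R[i]),
    forall x y, entry M x y = \sum_j f j x * (f j y)^*.

Lemma gram_conj_ge0 (T : finType) (M U : operator R T) z :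
  is_gram M -> 0 <= entry (U *m M *m U^t*) z z.
Proof.
case=> J [f fE].
have -> : entry (U *m M *m U^t*) z z = \sum_j `|\sum_x entry U z x * f j x| ^+ 2.
  rewrite entry_mul; under eq_bigr => y _.
    rewrite entry_mul entry_adj mulr_suml.
    under eq_bigr => x _ do rewrite fE mulr_sumr mulr_suml.
    rewrite exchange_big /=; over.
  rewrite exchange_big; apply: eq_bigr => j _ /=.
  rewrite normCK rmorph_sum mulr_sumr; apply: eq_bigr => y _ /=.
  rewrite mulr_suml; apply: eq_bigr => x _.
  by rewrite rmorphM /=; ring.
by apply: sumr_ge0 => j _; rewrite exprn_ge0.
Qed.

Lemma hermsymmx_entry (T : finType) (M : operator R T) x y :
  M \is hermsymmx -> entry M x y = (entry M y x)^*.
Proof.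
by move/is_hermitianmxP; rewrite expr0 scale1r => ME; rewrite {1}ME entry_adj.
Qed.

Lemma state_gram (T : finType) (rho : operator R T) : is_state rho -> is_gram rho.
Proof.
case=> rhoH rhoP _; pose P := spectralmx rho; pose d := spectral_diag rho.
have Pu : P \is unitarymx := spectral_unitarymx rho.
have rhoE : rho = P^t* *m diag_mx d *m P.
  by rewrite -invmx_unitary //; apply/orthomx_spectralP/hermitian_normalmx.
have d0 i : 0 <= d 0 i.
  have := rhoP (row i P); rewrite -row_mul.
  have -> : (row i (P *m rho) *m (row i P)^t*) 0 0 = (P *m rho *m P^t*) i i.
    by rewrite [LHS]mxE [RHS]mxE; apply: eq_bigr => j _; rewrite !mxE.
  have PP : P *m P^t* = 1%:M by apply/unitarymxP.
  by rewrite rhoE !mulmxA PP mul1mx -mulmxA PP mulmx1 mxE eqxx mulr1n.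
exists 'I_#|{: bits T}|, (fun i x => sqrtC (d 0 i) * (P i (enum_rank x))^*) => x y.
rewrite /entry {1}rhoE mxE; apply: eq_bigr => i _.
rewrite mxE (bigD1 i) //= !mxE eqxx mulr1n big1 ?addr0 => [|k ki]; last first.
  by rewrite !mxE (negPf ki) mulr0n mulr0.
rewrite rmorphM /= conjCK.
have -> : (sqrtC (d 0 i))^* = sqrtC (d 0 i) by apply: CrealP; rewrite ger0_real // sqrtC_ge0.
by rewrite -{1}[d 0 i]sqrtCK; ring.
Qed.

Lemma input_state_gram n N (rho : operator R 'I_n) :
  is_gram rho -> is_gram (input_state (8 * N) 0 rho).
Proof.
case=> J [f fE].
exists {ffun ('I_N * bool) * (bool * bool) -> J}%type,
  (fun (g : {ffun ('I_N * bool) * (bool * bool) -> J}) x => \prod_p f (g p) (split_copies x p.1 p.2)) => x y.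
rewrite entry_input_state pair_bigA /=.
under eq_bigr => p _ do rewrite fE.
rewrite bigA_distr_bigA; apply: eq_bigr => g _.
by rewrite rmorph_prod -big_split.
Qed.

End Gram.

(** * The four-copy trace as a norm of the realignment *)

Section Glue.
Variables (R : rcfType) (n : nat) (A : {set 'I_n}).
Local Notation bA := (bits (side A)).
Local Notation bB := (bits (side (~: A))).

Definition glue (a : bA) (b : bB) : bits 'I_n :=
  [ffun i => if insub i is Some j then a j
             else if insub i is Some j then b j else false].

Lemma glueA a b : restrict_bits A (glue a b) = a.
Proof. by apply/ffunP => i; rewrite !ffunE valK. Qed.

Lemma glueB a b : restrict_bits (~: A) (glue a b) = b.
Proof.
apply/ffunP => i; rewrite !ffunE valK insubF //.
by have := valP i; rewrite inE => /negbTE.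
Qed.

Lemma restrictK x : glue (restrict_bits A x) (restrict_bits (~: A) x) = x.
Proof.
apply/ffunP => i; rewrite ffunE; case: insubP => [j _ <-|iA]; first by rewrite ffunE.
case: insubP => [j _ <-|]; first by rewrite ffunE.
by rewrite inE iA.
Qed.

Lemma sum_glue (F : bits 'I_n -> R[i]) : \sum_x F x = \sum_a \sum_b F (glue a b).
Proof.
rewrite pair_bigA (reindex (fun p : bA * bB => glue p.1 p.2)) //=.
exists (fun x => (restrict_bits A x, restrict_bits (~: A) x)) => [[a b]|x] _ /=.
  by rewrite glueA glueB.
exact: restrictK.
Qed.

Variable rho : operator R 'I_n.
(* Rows are labelled by matrix units on [A], columns by matrix units on [~: A]. *)
Definition realign (u : bA * bA) (v : bB * bB) : R[i] :=
  entry rho (glue u.1 v.1) (glue u.2 v.2).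

Lemma sum_glue2 (F : bits 'I_n -> bits 'I_n -> R[i]) :
  \sum_x \sum_y F x y =
  \sum_(u : bA * bA) \sum_(v : bB * bB) F (glue u.1 v.1) (glue u.2 v.2).
Proof.
rewrite sum_glue; under eq_bigr => a _ do under eq_bigr => b _ do rewrite sum_glue.
under eq_bigr => a _ do rewrite exchange_big /=.
rewrite pair_bigA /=; apply: eq_bigr => -[a a'] _.
by rewrite pair_bigA.
Qed.

Local Notation U := (bA * bA)%type.
Local Notation V := (bB * bB)%type.
Local Notation slot := (bool * bool)%type.

Definition bit_pick (T : Type) (c : bool) (p : T * T) : T := if c then p.2 else p.1.
Definition flip_pair (T : Type) (p : T * T) : T * T := (p.2, p.1).

(* The four copies of a block: [u_b] holds the A-parts of copies [(0,b)] and
   [(1,b)], and [v_a] the B-parts of copies [(a,0)] and [(a,1)]. *)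
Definition quad_of (p : (U * U) * (V * V)) : {ffun slot -> bits 'I_n} :=
  [ffun ab : slot => glue (bit_pick ab.1 (bit_pick ab.2 p.1))
                          (bit_pick ab.2 (bit_pick ab.1 p.2))].

Lemma quad_of_bij : bijective quad_of.
Proof.
pose rA := restrict_bits A; pose rB := restrict_bits (~: A).
exists (fun y : {ffun slot -> bits 'I_n} => (((rA (y (false, false)), rA (y (true, false))),
                   (rA (y (false, true)), rA (y (true, true)))),
                  ((rB (y (false, false)), rB (y (false, true))),
                   (rB (y (true, false)), rB (y (true, true)))))).
  by move=> [[[a1 a2] [a3 a4]] [[b1 b2] [b3 b4]]]; rewrite !ffunE /= /rA /rB !glueA !glueB.
by move=> y; apply/ffunP => -[[] []]; rewrite ffunE /= restrictK.
Qed.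

Definition mask_of (i : nat) : bool := if insub i is Some j then j \in A else false.

(** In these coordinates the swaps on A exchange the two entries of each u_b and those on the
    complement exchange the two entries of each v_a. *)
Lemma swap_quad_of p ab :
  swap_quad mask_of (quad_of p) ab =
  glue (bit_pick (~~ ab.1) (bit_pick ab.2 p.1)) (bit_pick (~~ ab.2) (bit_pick ab.1 p.2)).
Proof.
apply/ffunP => i; rewrite !ffunE /mask_of valK.
case: insubP => [j -> _|/negbTE ->]; last by case: insubP => [j _ _|] //=; rewrite addbT addbF.
by rewrite /= addbT addbF.
Qed.

Lemma sum_pair (S T : finType) (F : S * T -> R[i]) :
  \sum_p F p = \sum_a \sum_b F (a, b).
Proof. by rewrite pair_bigA; apply: eq_bigr => -[]. Qed.

Lemma prod_slot (F : slot -> R[i]) :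
  \prod_ab F ab = F (false, false) * F (false, true) * F (true, false) * F (true, true).
Proof.
transitivity (\prod_(a : bool) \prod_(b : bool) F (a, b)).
  by rewrite pair_bigA; apply: eq_bigr => -[].
by rewrite !big_bool /=; ring.
Qed.

Hypothesis rhoH : rho \is hermsymmx.

Lemma realign_flip u v : realign (flip_pair u) (flip_pair v) = (realign u v)^*.
Proof. by rewrite /realign hermsymmx_entry. Qed.

Lemma flip_pair_bij (T : finType) : bijective (@flip_pair T).
Proof. by exists (@flip_pair T) => -[]. Qed.

(** Copy (a, b) contributes T at (u_b, v_a), with the labels of u_b transposed when a = 0 and those
    of v_a when b = 0. Hermiticity turns a double transposition into a conjugate; substituting the
    transposes of u_1 and v_1 removes the single ones and leaves the four factors of a squared
    [gram_entry]. *)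
Lemma quad_value_gram : quad_value rho mask_of = gram_norm realign.
Proof.
rewrite /quad_value (reindex quad_of); last exact/onW_bij/quad_of_bij.
rewrite sum_pair sum_pair.
rewrite /gram_norm; apply: eq_bigr => u0 _.
rewrite [RHS](reindex (@flip_pair bA)) /=; last exact/onW_bij/flip_pair_bij.
apply: eq_bigr => u1 _.
rewrite sum_pair normCK rmorph_sum /gram_entry mulr_suml; apply: eq_bigr => v0 _.
rewrite (reindex (@flip_pair bB)) /=; last exact/onW_bij/flip_pair_bij.
rewrite mulr_sumr; apply: eq_bigr => v1 _.
rewrite prod_slot !swap_quad_of !ffunE /=.
have := realign_flip u0 v0; have := realign_flip (flip_pair u1) v1.
case: u0 u1 v0 v1 => [a1 a2] [a3 a4] [b1 b2] [b3 b4].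
rewrite /realign /flip_pair /bit_pick /= => -> <-.
rewrite rmorphM /= conjCK; ring.
Qed.

End Glue.
Arguments realign {R n} A rho u v.

(** * Overlaps as values of the realigned form *)

Section Overlap.
Variables (R : rcfType) (n : nat).
Implicit Types (A : {set 'I_n}) (rho O : operator R 'I_n).

Lemma eq_quad_value rho (m m' : nat -> bool) : m =1 m' -> quad_value rho m = quad_value rho m'.
Proof.
move=> mm; apply: eq_bigr => y _; apply: eq_bigr => ab _; congr (entry rho _ _).
by apply/ffunP => i; rewrite !ffunE mm.
Qed.

Lemma frob_realign A rho : rho \is hermsymmx -> frob_norm (realign A rho) = \tr (rho *m rho).
Proof.
move=> rhoH; rewrite /frob_norm -(sum_glue2 A (fun x y => `|entry rho x y| ^+ 2)).
rewrite trace_entry; apply: eq_bigr => x _; rewrite entry_mul; apply: eq_bigr => y _.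
by rewrite normCK -hermsymmx_entry.
Qed.

Lemma gram_norm_single (C : numClosedFieldType) (U V : finType) (T : U -> V -> C) :
  #|U| = 1%N -> gram_norm T = frob_norm T ^+ 2.
Proof.
case/fintype1 => u0 Uu; have sumU (F : U -> C) : \sum_u F u = F u0.
  by rewrite (bigD1 u0) //= big1 ?addr0 // => u; rewrite (Uu u) eqxx.
rewrite /gram_norm /frob_norm !sumU; rewrite -[in RHS](ger0_norm (_ : 0 <= \sum_v `|T u0 v| ^+ 2)).
  congr (`|_| ^+ 2); apply: eq_bigr => v _.
  by rewrite mulrC normCK.
by apply: sumr_ge0 => v _; rewrite exprn_ge0.
Qed.

(** For empty A there is one matrix unit on A, so T is a single row of squared norm tr rho^2, and
    its Gram norm is the square of that. *)
Lemma quad_value_purity rho (m : nat -> bool) : rho \is hermsymmx ->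
  (forall i, m i = false) -> quad_value rho m = (\tr (rho *m rho)) ^+ 2.
Proof.
move=> rhoH m0; rewrite (@eq_quad_value _ _ (@mask_of n finset.set0)); last first.
  by move=> i; rewrite m0 /mask_of; case: insubP => // j; rewrite inE.
rewrite quad_value_gram // gram_norm_single ?frob_realign //.
rewrite card_prod card_ffun card_bool (_ : #|side (finset.set0 : {set 'I_n})| = 0%N) //.
by rewrite card_sig; apply: eq_card0 => i; rewrite !inE.
Qed.

Definition op_fun (T : finType) (M : operator R T) (u : bits T * bits T) : R[i] :=
  entry M u.1 u.2.

Lemma hs_dot (T : finType) (M N : operator R T) :
  \tr (M^t* *m N) = dot (op_fun M) (op_fun N).
Proof.
rewrite trace_entry /dot sum_pair exchange_big; apply: eq_bigr => x _.
by rewrite entry_mul; apply: eq_bigr => y _; rewrite entry_adj.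
Qed.

Lemma hs_realign A O rho :
  \tr (O^t* *m rho) = \sum_u \sum_v (entry O (glue u.1 v.1) (glue u.2 v.2))^* * realign A rho u v.
Proof.
rewrite -(sum_glue2 A (fun x y => (entry O x y)^* * entry rho x y)).
by rewrite hs_dot /dot sum_pair.
Qed.

Lemma hs_optensor A (OA : operator R (side A)) (OB : operator R (side (~: A))) rho :
  \tr ((optensor OA OB)^t* *m rho) = pairing (realign A rho) (op_fun OA) (op_fun OB).
Proof.
rewrite (hs_realign A); apply: eq_bigr => u _; apply: eq_bigr => v _.
by rewrite entry_opmx !glueA !glueB rmorphM.
Qed.

Lemma orthonormal_op (T I : finType) (F : I -> operator R T) :
  hs_orthonormal F -> orthonormal_family (fun i => op_fun (F i)).
Proof. by move=> FO i j; rewrite -hs_dot. Qed.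

Lemma Re_norm2 (z : R[i]) k : `|z| ^+ k = (complex.Re (`|z| ^+ k))%:C%C.
Proof. by rewrite RRe_real // ger0_real // exprn_ge0. Qed.

Lemma Re_le (x y : R[i]) : x <= y -> complex.Re x <= complex.Re y.
Proof. by rewrite lecE => /andP[]. Qed.

Variables (A : {set 'I_n}) (rho : operator R 'I_n).
Hypothesis rhoH : rho \is hermsymmx.

Lemma purityE : \tr (rho *m rho) = (purity rho)%:C%C.
Proof.
rewrite /purity RRe_real // -(frob_realign A) // ger0_real //.
by apply: sumr_ge0 => u _; apply: sumr_ge0 => v _; rewrite exprn_ge0.
Qed.

Lemma real_complexC (x : R) : x%:C%C \is Num.real.
Proof. by apply/complex_realP; exists x. Qed.

Lemma normC_real (x : R) : `|x%:C%C| ^+ 2 = (x ^+ 2)%:C%C.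
Proof. by rewrite normCK (CrealP (real_complexC x)) rmorphXn. Qed.

Lemma hs_self_ge0 (O : operator R 'I_n) : 0 <= \tr (O^t* *m O).
Proof. by rewrite hs_dot dot_self sqnorm_ge0. Qed.

Lemma overlap_le O r : 0 < purity rho -> op_schmidt_rank_le A O r ->
  overlap O rho ^+ 2 * purity rho ^+ 2 <= r%:R * complex.Re (gram_norm (realign A rho)).
Proof.
move=> P0 [m [lam [OA [OB [[l0 l1 OAo OBo OE] Sr]]]]].
pose mu i : R[i] := (Num.sqrt (lam i))%:C%C.
pose S := \sum_i (mu i)^* * pairing (realign A rho) (op_fun (OA i)) (op_fun (OB i)).
have muR i : (mu i)^* = mu i by apply: CrealP; apply: real_complexC.
have SE : S = (sqrtC (\tr (O^t* *m O)))^-1 * \tr (O^t* *m rho).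
  transitivity (\tr (((sqrtC (\tr (O^t* *m O)))^-1 *: O)^t* *m rho)).
    rewrite OE linear_sum /= raddf_sum mulmx_suml raddf_sum; apply: eq_bigr => i _.
    by rewrite linearZ /= map_mxZ -scalemxAl mxtraceZ hs_optensor.
  rewrite linearZ /= map_mxZ -scalemxAl mxtraceZ; congr (_ * _).
  rewrite fmorphV; congr (_^-1); apply: CrealP.
  by rewrite ger0_real // sqrtC_ge0 hs_self_ge0.
have ovE : overlap O rho = complex.Re (`|S| ^+ 2) / purity rho.
  rewrite /overlap purityE.
  have -> : `|\tr (O^t* *m rho)| ^+ 2 / ((purity rho)%:C%C * \tr (O^t* *m O))
      = `|S| ^+ 2 / (purity rho)%:C%C.
    rewrite SE normrM exprMn ger0_norm ?invr_ge0 ?sqrtC_ge0 ?hs_self_ge0 //.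
    by rewrite exprVn sqrtCK invfM; ring.
  by rewrite {1}Re_norm2 -fmorph_div.
have lamE : sqnorm mu = 1.
  rewrite /sqnorm; under eq_bigr => i _ do rewrite /mu normC_real sqr_sqrtr //.
  by rewrite -rmorph_sum /= l1.
have Smu : (#|[set i | mu i != 0%R]| <= r)%N.
  apply: leq_trans Sr; apply: subset_leq_card; apply/fintype.subsetP => i; rewrite !inE.
  by apply: contraNneq => l0i; rewrite /mu l0i sqrtr0.
have := schmidt_overlap_le (realign A rho) (orthonormal_op OAo) (orthonormal_op OBo) lamE Smu.
rewrite -/S (exprM _ 2 2) [X in X ^+ 2]Re_norm2 -rmorphXn.
rewrite -[gram_norm _]RRe_real ?ger0_real ?gram_norm_ge0 // -(rmorph_nat (real_complex R)) -rmorphM lecR.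
rewrite ovE -exprMn divfK //; exact: lt0r_neq0.
Qed.

Lemma rank_one_overlap (a : bits (side A) * bits (side A) -> R[i])
    (b : bits (side (~: A)) * bits (side (~: A)) -> R[i]) :
  sqnorm a = 1 -> sqnorm b = 1 ->
  exists O : operator R 'I_n, [/\ O != 0, op_schmidt_rank_le A O 1
    & overlap O rho = complex.Re (`|pairing (realign A rho) a b| ^+ 2) / purity rho].
Proof.
move=> a1 b1.
pose OA : operator R (side A) := opmx (fun x y => a (x, y)).
pose OB : operator R (side (~: A)) := opmx (fun x y => b (x, y)).
have aE : op_fun OA =1 a by case=> x y; rewrite /op_fun entry_opmx.
have bE : op_fun OB =1 b by case=> x y; rewrite /op_fun entry_opmx.
pose O := optensor OA OB.
have pairE (T T' : bits (side A) * bits (side A) -> bits (side (~: A)) * bits (side (~: A)) -> R[i]) :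
    T =2 T' -> pairing T (op_fun OA) (op_fun OB) = pairing T' a b.
  by move=> TT; apply: eq_bigr => u _; apply: eq_bigr => v _; rewrite aE bE TT.
have OO : \tr (O^t* *m O) = 1.
  (* The norm of [O] is computed as its overlap with itself: [hs_optensor] is applied with [O] in
     the place of [rho]. *)
  rewrite hs_optensor (pairE _ (fun u v => a u * b v)); last first.
    by move=> u v; rewrite /realign entry_opmx !glueA !glueB -aE -bE.
  rewrite -[1]mulr1 -{1}a1 -b1 /pairing /sqnorm mulr_suml; apply: eq_bigr => u _.
  by rewrite mulr_sumr; apply: eq_bigr => v _; rewrite !normCK; ring.
have ON0 : O != 0.
  apply: contra_eq_neq OO => ->; rewrite mulmx0 mxtrace0 eq_sym; exact: oner_neq0.
exists O; split=> //.
  exists 1%N, (fun=> 1), (fun=> OA), (fun=> OB); split; last first.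
    by apply: leq_trans (max_card _) _; rewrite card_ord.
  split=> //.
  - by rewrite big_ord1.
  - move=> i j; rewrite !ord1 eqxx hs_dot -a1 -dot_self.
    by apply: eq_bigr => u _; rewrite aE.
  - move=> i j; rewrite !ord1 eqxx hs_dot -b1 -dot_self.
    by apply: eq_bigr => u _; rewrite bE.
  - by rewrite big_ord1 OO sqrtC1 invr1 sqrtr1.
rewrite /overlap OO mulr1 hs_optensor (pairE _ (realign A rho)) //.
by rewrite {1}Re_norm2 purityE -fmorph_div.
Qed.

Lemma gram_norm_le_overlap (eps : R) : 0 < purity rho -> 0 <= eps ->
  (forall O, O != 0 -> op_schmidt_rank_le A O 1 -> overlap O rho <= eps) ->
  complex.Re (gram_norm (realign A rho)) <= eps * purity rho ^+ 2.
Proof.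
move=> P0 eps0 bound; set T := realign A rho.
have k0 : 0 <= (eps * purity rho)%:C%C :> R[i] by rewrite ler0c mulr_ge0 // ltW.
have pairZ a b x y : pairing T (fun u => x * a u) (fun v => y * b v) = x^* * y^* * pairing T a b.
  rewrite /pairing mulr_sumr; apply: eq_bigr => u _; rewrite mulr_sumr; apply: eq_bigr => v _.
  by rewrite !rmorphM; ring.
have sqnormZ (I : finType) (f : I -> R[i]) x : sqnorm (fun i => x * f i) = `|x| ^+ 2 * sqnorm f.
  by rewrite /sqnorm mulr_sumr; apply: eq_bigr => i _; rewrite normrM exprMn.
have normalize (I : finType) (f : I -> R[i]) : sqnorm f != 0 ->
    `|(sqrtC (sqnorm f))^-1| ^+ 2 = (sqnorm f)^-1.
  by move=> f0; rewrite ger0_norm ?invr_ge0 ?sqrtC_ge0 ?sqnorm_ge0 // exprVn sqrtCK.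
have := @gram_norm_le _ _ _ T _ k0 _.
rewrite frob_realign // purityE -rmorphM -[gram_norm _]RRe_real ?ger0_real ?gram_norm_ge0 //.
rewrite lecR -mulrA => H; apply: H => a b.
(* A vector of norm 0 cannot be normalised to a product operator, but its pairing vanishes by
   Cauchy-Schwarz. *)
have [a0|an0] := eqVneq (sqnorm a) 0.
  have := cauchy_schwarz a (fun u => \sum_v (b v)^* * T u v).
  by rewrite -pairing_dotr a0 !mul0r mulr0.
have [b0|bn0] := eqVneq (sqnorm b) 0.
  have := cauchy_schwarz b (fun v => \sum_u (a u)^* * T u v).
  by rewrite -pairing_dotl b0 !mul0r !mulr0.
have [||O [On0 Or ovE]] := @rank_one_overlap (fun u => (sqrtC (sqnorm a))^-1 * a u)
   (fun v => (sqrtC (sqnorm b))^-1 * b v).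
- by rewrite sqnormZ normalize // mulVf.
- by rewrite sqnormZ normalize // mulVf.
have := bound O On0 Or; rewrite ovE ler_pdivrMr // -lecR -Re_norm2 pairZ !normrM !exprMn !norm_conjC.
have pos (I : finType) (f : I -> R[i]) : sqnorm f != 0 -> 0 < sqnorm f.
  by move=> f0; rewrite lt_def f0 sqnorm_ge0.
by rewrite !normalize // -invfM mulrC ler_pdivrMr ?mulr_gt0 ?pos.
Qed.

End Overlap.

(** * Concentration *)

Section Chebyshev.
Variables (R : realFieldType) (Z I : finType) (pr : Z -> R) (sg : I -> Z -> R) (g w : I -> R).
Hypotheses (pr_ge0 : forall z, 0 <= pr z) (pr1 : \sum_z pr z = 1).
Hypothesis sg_mean : forall i, \sum_z pr z * sg i z = g i.
Hypothesis sg_pair : forall i j, i != j -> \sum_z pr z * (sg i z * sg j z) = g i * g j.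
Hypothesis sg2 : forall i z, sg i z ^+ 2 = 1.

Definition statistic (z : Z) : R := \sum_i w i * sg i z.
Definition statistic_mean : R := \sum_i w i * g i.

(** Uncorrelated signs leave only the diagonal terms, and a sign of mean g has variance 1 - g^2 <=
    1. *)
Lemma statistic_variance :
  \sum_z pr z * (statistic z - statistic_mean) ^+ 2 <= \sum_i w i ^+ 2.
Proof.
have -> : \sum_z pr z * (statistic z - statistic_mean) ^+ 2
   = \sum_i \sum_j w i * w j * \sum_z pr z * ((sg i z - g i) * (sg j z - g j)).
  transitivity (\sum_z \sum_i \sum_j w i * w j * (pr z * ((sg i z - g i) * (sg j z - g j)))).
    apply: eq_bigr => z _; rewrite /statistic /statistic_mean -sumrB expr2 mulr_suml mulr_sumr.
    apply: eq_bigr => i _; rewrite !mulr_sumr; apply: eq_bigr => j _; ring.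
  rewrite exchange_big; apply: eq_bigr => i _; rewrite exchange_big; apply: eq_bigr => j _.
  by rewrite mulr_sumr.
apply: ler_sum => i _; rewrite (bigD1 i) //= [X in _ + X]big1 ?addr0 => [|j ji]; last first.
  have -> : \sum_z pr z * ((sg i z - g i) * (sg j z - g j)) =
     \sum_z pr z * (sg i z * sg j z) - g j * (\sum_z pr z * sg i z)
     - g i * (\sum_z pr z * sg j z) + g i * g j * (\sum_z pr z).
    rewrite !mulr_sumr -!sumrB -big_split; apply: eq_bigr => z _ /=; ring.
  by rewrite sg_pair 1?eq_sym // !sg_mean pr1; ring.
have -> : \sum_z pr z * ((sg i z - g i) * (sg i z - g i)) = 1 - g i ^+ 2.
  transitivity (\sum_z pr z - (g i *+ 2) * (\sum_z pr z * sg i z) + g i ^+ 2 * \sum_z pr z).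
    rewrite !mulr_sumr -!sumrB -big_split; apply: eq_bigr => z _ /=.
    rewrite -[in RHS](mulr1 (pr z)) -{1}(sg2 i z); ring.
  by rewrite sg_mean pr1; ring.
by rewrite -expr2 ler_piMr ?sqr_ge0 // gerBl sqr_ge0.
Qed.

Lemma chebyshev (P : pred Z) (t : R) : 0 < t ->
  (forall z, P z -> t <= `|statistic z - statistic_mean|) ->
  \sum_(z | P z) pr z <= (\sum_i w i ^+ 2) / t ^+ 2.
Proof.
move=> t0 Pt; rewrite ler_pdivlMr ?exprn_gt0 //.
apply: le_trans statistic_variance; rewrite mulr_suml.
rewrite [leRHS](bigID P) /= -[leLHS]addr0; apply: lerD; last first.
  by apply: sumr_ge0 => z _; rewrite mulr_ge0 ?sqr_ge0.
apply: ler_sum => z /Pt tz; rewrite ler_wpM2l // -[leRHS]real_normK ?num_real //.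
by rewrite ler_pXn2r ?nnegrE ?normr_ge0 // ltW.
Qed.

End Chebyshev.

Section Purity.
Variables (R : rcfType) (T : finType) (rho : operator R T).

(** Compare tr rho^2 with (tr rho)^2 term by term: |rho_xy|^2 <= rho_xx rho_yy is Cauchy-Schwarz for
    the Gram vectors. *)
Lemma purity_le1 : is_state rho -> purity rho <= 1.
Proof.
move=> st; have [rhoH _ tr1] := st; have [J [f fE]] := state_gram st.
suff : \tr (rho *m rho) <= 1 by move/Re_le.
have -> : 1 = \sum_x \sum_y entry rho x x * entry rho y y :> R[i].
  under eq_bigr => x _ do rewrite -mulr_sumr -trace_entry tr1 mulr1.
  by rewrite -trace_entry.
rewrite trace_entry; apply: ler_sum => x _; rewrite entry_mul; apply: ler_sum => y _.
rewrite [entry rho y x]hermsymmx_entry // -normCK.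
have -> : entry rho x y = dot (fun j => (f j x)^*) (fun j => (f j y)^*).
  by rewrite fE; apply: eq_bigr => j _; rewrite conjCK.
apply: le_trans (cauchy_schwarz _ _) _.
rewrite !fE le_eqVlt; apply/orP; left; apply/eqP.
by congr (_ * _); apply: eq_bigr => j _; rewrite norm_conjC normCK.
Qed.

End Purity.

Section MaxOverlap.
Local Open Scope classical_set_scope.
Variables (R : realType) (n : nat) (A : {set 'I_n}) (rho : operator R 'I_n) (r : nat).
Hypotheses (rhoH : rho \is hermsymmx) (P0 : 0 < purity rho).
Local Notation G := (complex.Re (gram_norm (realign A rho))).

(** Serves both cases: it bounds the supremum in case (a), and in case (b) it provides the
    boundedness without which the supremum would not dominate the individual overlaps. *)
Lemma overlap_ub O : op_schmidt_rank_le A O r ->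
  overlap O rho <= Num.sqrt (r%:R * G) / purity rho.
Proof.
move=> Or; have := overlap_le rhoH P0 Or; rewrite -exprMn => H.
rewrite ler_pdivlMr //; apply: le_trans (ler_norm _) _.
by rewrite -sqrtr_sqr ler_wsqrtr.
Qed.

Lemma overlap_ge_gram (eps : R) : 0 <= eps -> eps <= max_overlap A r rho ->
  eps ^+ 2 * purity rho ^+ 2 <= r%:R * G.
Proof.
move=> e0 emax.
have G0 : 0 <= G by rewrite -ler0c RRe_real ?ger0_real ?gram_norm_ge0.
suff : eps <= Num.sqrt (r%:R * G) / purity rho.
  rewrite ler_pdivlMr // => H.
  rewrite -[leRHS]sqr_sqrtr ?mulr_ge0 // -exprMn ler_pXn2r ?nnegrE ?sqrtr_ge0 //.
  by rewrite mulr_ge0 // ltW.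
apply: le_trans emax _; rewrite /max_overlap.
(* The supremum of the empty set is 0 by convention, and the right-hand side is nonnegative. *)
set S := [set f | _]; have [->|/set0P S0] := eqVneq S set0.
  by rewrite sup0 divr_ge0 ?sqrtr_ge0 // ltW.
apply: ge_sup => // f [O [_ Or ->]]; exact: overlap_ub.
Qed.

Lemma overlap_le_gram (eps : R) : (0 < r)%N -> 0 <= eps -> max_overlap A r rho <= eps ->
  G <= eps * purity rho ^+ 2.
Proof.
move=> r0 e0 emax; apply: gram_norm_le_overlap => // O On0 O1; apply: le_trans emax.
apply: ub_le_sup.
  by exists (Num.sqrt (r%:R * G) / purity rho) => f [O' [_ Or ->]]; apply: overlap_ub.
exists O; split=> //; case: O1 => [m [lam [OA [OB [dec le1]]]]].
exists m, lam, OA, OB; split=> //; exact: leq_trans le1 r0.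
Qed.

End MaxOverlap.

Section PolyBound.

(** Closed under sums and products, so the polynomial for the running time never has to be written
    out. *)
Definition poly_bounded (f : nat -> nat) : Prop :=
  exists P : {poly nat}, forall n, (f n <= P.[n])%N.

Lemma poly_bounded_const c : poly_bounded (fun=> c).
Proof. by exists c%:P => n; rewrite hornerC. Qed.

Lemma poly_bounded_id : poly_bounded id.
Proof. by exists 'X => n; rewrite hornerX. Qed.

Lemma poly_bounded_horner (p : {poly nat}) : poly_bounded (fun n => p.[n]).
Proof. by exists p. Qed.

Lemma poly_bounded_add f g : poly_bounded f -> poly_bounded g ->
  poly_bounded (fun n => f n + g n)%N.
Proof. by move=> [P HP] [Q HQ]; exists (P + Q) => n; rewrite hornerD leq_add. Qed.

Lemma poly_bounded_mul f g : poly_bounded f -> poly_bounded g ->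
  poly_bounded (fun n => f n * g n)%N.
Proof. by move=> [P HP] [Q HQ]; exists (P * Q) => n; rewrite hornerM leq_mul. Qed.

Lemma poly_bounded_succ f : poly_bounded f -> poly_bounded (fun n => (f n).+1).
Proof. by move=> [P HP]; exists (P + 1) => n; rewrite hornerD hornerC -addn1; apply: leq_add. Qed.

Variable V : nat -> nat.
Hypothesis VP : poly_bounded V.

Lemma poly_bounded_eval_max e : poly_bounded (fun n => eval_max (V n) e).
Proof.
elim: e => //= [c|a IHa b IHb|a IHa b IHb]; first exact: poly_bounded_const.
- exact: poly_bounded_add.
- exact: poly_bounded_mul.
Qed.

Lemma poly_bounded_cost_max e : poly_bounded (fun n => cost_max (V n) e).
Proof.
elim: e => /= [_|_|a IHa b IHb|a IHa b IHb|a IHa b IHb];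
 do ?[exact: poly_bounded_const|exact: poly_bounded_eval_max|apply: poly_bounded_add|apply: poly_bounded_mul|by []].
Qed.

Lemma poly_bounded_block os : poly_bounded (fun n => block_cost_max (V n) os).
Proof.
apply: poly_bounded_succ; elim: os => [|o os IH] /=; first exact: poly_bounded_const.
apply: poly_bounded_add => //; case: o => *; try exact: poly_bounded_const.
by apply: poly_bounded_add; [exact: poly_bounded_cost_max|exact: poly_bounded_const].
Qed.

End PolyBound.

(** * The law of the measured signs *)

Section Distribution.
Variables (R : realType) (n N : nat) (A : {set 'I_n}) (rho : operator R 'I_n).
Hypothesis rho_state : is_state rho.
Let rhoH : rho \is hermsymmx := let: And3 h _ _ := rho_state in h.
Let tr1 : \tr rho = 1 := let: And3 _ _ h := rho_state in h.
Local Notation mask := (mask_of A).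
Local Notation G := (complex.Re (gram_norm (realign A rho))).
Variable gs : seq gate.
Hypothesis gsE : gs = bell_circuit (src n mask) (tgt n mask) (pair_list n N).
Local Notation idx := ('I_N * bool)%type.
Local Notation outcome := (bits 'I_(8 * N * n + 0)).

Definition prob (z : outcome) : R := @outcome_prob R n (8 * N) 0 gs rho z.

Definition sign (bh : idx) (z : outcome) : R :=
  (-1) ^+ pair_parity mask n (wire z) bh.1 bh.2.

Definition sign_mean (bh : idx) : R := if bh.2 then purity rho ^+ 2 else G.

Lemma entry_outcome_ge0 z :
  0 <= entry (circuit_mx R (8 * N * n + 0) gs *m input_state (8 * N) 0 rho
              *m (circuit_mx R (8 * N * n + 0) gs)^t*) z z.
Proof. exact/gram_conj_ge0/input_state_gram/state_gram. Qed.

Lemma prob_ge0 z : 0 <= prob z.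
Proof. exact: (Re_le (entry_outcome_ge0 z)). Qed.

Lemma quad_value_mean h :
  quad_value rho (half_mask mask h) = (if h then purity rho ^+ 2 else G)%:C%C.
Proof.
case: h.
  by rewrite quad_value_purity // (purityE A) // rmorphXn.
rewrite (@eq_quad_value _ _ _ _ mask) // quad_value_gram //.
by rewrite RRe_real // ger0_real // gram_norm_ge0.
Qed.

(** All moments at once: the empty, singleton and two-element predicates give total mass 1, the
    means, and the absence of correlation required by Chebyshev. *)
Lemma prob_signs (P : pred idx) :
  \sum_z prob z * \prod_(bh | P bh) sign bh z = \prod_(bh | P bh) sign_mean bh.
Proof.
pose S b h := [exists p : idx, [&& val p.1 == b, p.2 == h & P p]].
have SE (bh : idx) : S bh.1 bh.2 = P bh.
  apply/existsP/idP => [[[b h] /= /and3P[/eqP/val_inj bE /eqP hE]]|Pbh].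
    by rewrite bE hE; case: (bh).
  by exists bh; rewrite !eqxx.
apply: (fmorph_inj (real_complex R)); rewrite rmorph_sum rmorph_prod /=.
have := @sign_expectation R n N mask rho S gs tr1 gsE.
under [X in _ = X -> _]eq_bigr => bh _ do rewrite SE quad_value_mean.
rewrite -big_mkcond /= => <-; apply: eq_bigr => z _.
under [X in _ = X * _]eq_bigr => bh _ do rewrite SE.
rewrite -big_mkcond rmorphM rmorph_prod mulrC; congr (_ * _).
  by apply: eq_bigr => bh _; rewrite /sign /block_sign rmorphXn rmorphN1.
by rewrite /prob /outcome_prob /= RRe_real // ger0_real // entry_outcome_ge0.
Qed.

Lemma prob_sum1 : \sum_z prob z = 1.
Proof.
have := prob_signs pred0; rewrite big_pred0_eq => <-.
by apply: eq_bigr => z _; rewrite big_pred0_eq mulr1.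
Qed.

Lemma prob_sign i : \sum_z prob z * sign i z = sign_mean i.
Proof.
have := prob_signs (pred1 i); rewrite big_pred1_eq => <-.
by apply: eq_bigr => z _; rewrite big_pred1_eq.
Qed.

Lemma prob_sign2 i j : i != j ->
  \sum_z prob z * (sign i z * sign j z) = sign_mean i * sign_mean j.
Proof.
move=> ij; have pE (F : idx -> R) : \prod_(k | (k == i) || (k == j)) F k = F i * F j.
  rewrite (bigD1 i) ?eqxx //=; congr (_ * _).
  rewrite (big_pred1 j) // => k; rewrite /= -[RHS]/(k == j).
  by have [->|ki] := eqVneq k i; rewrite ?andbT // (negPf ij).
have := prob_signs (fun k => (k == i) || (k == j)); rewrite pE => <-.
by apply: eq_bigr => z _; rewrite pE.
Qed.

Lemma sign_sq i z : sign i z ^+ 2 = 1.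
Proof. exact: sqrr_sign. Qed.

Variable c : R.
(** Chosen so that the mean of the statistic is N (G - c P^2): comparing G with c P^2 becomes
    reading a sign. *)
Definition weight (bh : idx) : R := if bh.2 then - c else 1.

Lemma sum_idx (F : idx -> R) : \sum_i F i = \sum_b F (b, false) + \sum_b F (b, true).
Proof.
transitivity (\sum_b \sum_h F (b, h)); first by rewrite pair_bigA; apply: eq_bigr => -[].
by under eq_bigr do rewrite big_bool /= addrC; rewrite big_split.
Qed.

Lemma weight_norm : \sum_i weight i ^+ 2 = N%:R * (1 + c ^+ 2).
Proof.
rewrite sum_idx /weight /= expr1n sqrrN !sumr_const card_ord -mulr_natl -[_ *+ N]mulr_natl.
by ring.
Qed.

Lemma weight_mean : statistic_mean sign_mean weight = N%:R * (G - c * purity rho ^+ 2).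
Proof.
rewrite /statistic_mean sum_idx /weight /sign_mean /= !sumr_const card_ord.
by rewrite -mulr_natl -[_ *+ N]mulr_natl; ring.
Qed.

Lemma statistic_odd z :
  let odd h : nat := (\sum_(b <- iota 0 N) pair_parity mask n (wire z) b h)%N in
  statistic sign weight z =
  (N%:R - 2 * (odd false)%:R) - c * (N%:R - 2 * (odd true)%:R).
Proof.
move=> odd; have oddE h : N%:R - 2 * (odd h)%:R = \sum_(b < N) sign (b, h) z.
  rewrite /odd (_ : iota 0 N = index_iota 0 N) ?big_mkord; last by rewrite /index_iota subn0.
  rewrite natr_sum mulr_sumr -[N in N%:R]card_ord -sumr_const -sumrB; apply: eq_bigr => b _.
  by rewrite /sign /=; case: pair_parity => /=; rewrite ?expr0 ?expr1; ring.
rewrite !oddE /statistic sum_idx /weight /= mulr_sumr -sumrN; congr (_ + _).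
  by apply: eq_bigr => b _; rewrite mul1r.
by apply: eq_bigr => b _; rewrite mulNr.
Qed.

End Distribution.

(** * Thresholds and sample size *)

Section Numeric.
Variables (R : realFieldType) (P eps1 eps2 : R) (p q r e1 e2 kap D : nat).
Hypothesis DE : D = (12 * q)%N.
Local Notation delta := (eps1 ^+ 2 / r%:R - eps2).
Hypotheses (p0 : (0 < p)%N) (q0 : (0 < q)%N) (r0 : (0 < r)%N) (kap0 : (0 < kap)%N).
Hypotheses (eps1_01 : 0 <= eps1 <= 1) (eps2_01 : 0 <= eps2 <= 1).
Hypotheses (Pp : p%:R^-1 <= P) (P1 : P <= 1) (gap : q%:R^-1 < delta * P ^+ 2).
Hypotheses (e1P : e1%:R <= eps1 * D%:R < e1.+1%:R) (e2P : e2%:R <= eps2 * D%:R < e2.+1%:R).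

Lemma purity_gt0 : 0 < P.
Proof. by apply: lt_le_trans Pp; rewrite invr_gt0 ltr0n. Qed.

Lemma purity_sq_le1 : P ^+ 2 <= 1.
Proof. by rewrite expr_le1 // ltW // purity_gt0. Qed.

Lemma delta_gt0 : 0 < delta.
Proof.
have : 0 < delta * P ^+ 2 by apply: lt_trans gap; rewrite invr_gt0 ltr0n.
by rewrite pmulr_lgt0 // exprn_gt0 // purity_gt0.
Qed.

(* This is what makes the resolution 1 / D fine enough. *)
Lemma q_delta : 1 <= q%:R * delta.
Proof.
have q0' : 0 < q%:R :> R by rewrite ltr0n.
rewrite -ler_pdivrMl // mulr1; apply: le_trans (ltW gap) _.
by rewrite ler_piMr ?purity_sq_le1 // ltW ?delta_gt0.
Qed.

(** Since delta <= 1/r and q delta >= 1. It makes a running time that depends on r polynomial in n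
    alone. *)
Lemma rank_le_q : (r <= q)%N.
Proof.
have r0' : 0 < r%:R :> R by rewrite ltr0n.
have d1 : delta <= r%:R^-1.
  have /andP[e10 e11] := eps1_01; have /andP[e20 _] := eps2_01.
  rewrite lerBlDr; apply: (@le_trans _ _ r%:R^-1); last by rewrite lerDl.
  by rewrite ler_piMl ?invr_ge0 ?ler0n // expr_le1.
have := le_trans q_delta (ler_wpM2l (ler0n _ q) d1).
by rewrite ler_pdivlMr // mul1r ler_nat.
Qed.

Lemma e1_le_D : (e1 <= D)%N.
Proof.
have /andP[_ e11] := eps1_01; have /andP[H _] := e1P.
by rewrite -(ler_nat R); apply: le_trans H _; rewrite ler_piMl // ler0n.
Qed.

Lemma e2_le_D : (e2 <= D)%N.
Proof.
have /andP[_ e11] := eps2_01; have /andP[H _] := e2P.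
by rewrite -(ler_nat R); apply: le_trans H _; rewrite ler_piMl // ler0n.
Qed.

Local Notation Dr := (D%:R : R).
Local Notation scaled := (Dr ^+ 2 * (r%:R * delta)).

Lemma scaledE : scaled = (eps1 * Dr) ^+ 2 - r%:R * (eps2 * Dr) * Dr.
Proof.
have r0' : r%:R != 0 :> R by rewrite pnatr_eq0 -lt0n.
by rewrite mulrBr mulrCA divff // mulr1; ring.
Qed.

Lemma D_gt0 : 0 < Dr. Proof. by rewrite ltr0n DE muln_gt0. Qed.

(** From D delta >= 12. Rounding down costs at most 2D in e1^2 and r D in r e2 D, that is 1/6 and
    1/12 of [scaled]; the 12 in D is chosen for these ratios. *)
Lemma scaled_lb : 12 * r%:R * Dr <= scaled.
Proof.
have := q_delta; have := D_gt0; set d := delta => D0 qd.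
have -> : scaled = r%:R * Dr * (Dr * d) by rewrite /d; ring.
have : 12 <= Dr * d by rewrite DE natrM -mulrA -[leLHS]mulr1 ler_pM2l ?ltr0n.
have : 0 <= r%:R * Dr by rewrite mulr_ge0 ?ler0n // ltW.
by move=> x0 y12; rewrite -mulrA [leLHS]mulrC; exact: ler_wpM2l.
Qed.

Lemma e1_sq : (eps1 * Dr) ^+ 2 - 2 * Dr <= (e1 * e1)%:R <= (eps1 * Dr) ^+ 2.
Proof.
have /andP[e11 e12] := e1P; have /andP[a b] := eps1_01.
have D0 := D_gt0; rewrite natrM; move: e12; rewrite -natr1.
have : 0 <= e1%:R :> R by rewrite ler0n.
have : eps1 * Dr <= Dr by rewrite ler_piMl // ltW.
move: e11; set E := eps1 * Dr; set e := e1%:R => H1 H2 H3 H4.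
have : 0 <= (e + 1 - E) * (E + e) by rewrite mulr_ge0; lra.
have : 0 <= (E - e) * (E + e) by rewrite mulr_ge0; lra.
by move=> *; apply/andP; split; nra.
Qed.

Lemma re2D : r%:R * (eps2 * Dr) * Dr - r%:R * Dr <= (r * e2 * D)%:R <= r%:R * (eps2 * Dr) * Dr.
Proof.
have /andP[e21 e22] := e2P; have D0 := D_gt0; rewrite !natrM.
move: e22; rewrite -natr1; have : 0 < r%:R :> R by rewrite ltr0n.
move: e21; set E := eps2 * Dr; set e := e2%:R; set rr := r%:R => H1 H2 H3.
have : 0 < rr * Dr by rewrite mulr_gt0.
have -> : rr * E * Dr = (rr * Dr) * E by ring.
have -> : rr * e * Dr = (rr * Dr) * e by ring.
set x := rr * Dr => x0 *; have : 0 <= x * (E - e) by rewrite mulr_ge0; lra.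
have : 0 <= x * (e + 1 - E) by rewrite mulr_ge0; lra.
by move=> *; apply/andP; split; nra.
Qed.

Local Notation d := (e1 * e1 - r * e2 * D)%N.

Lemma d_bounds : 5 / 6 * scaled <= d%:R <= 13 / 12 * scaled.
Proof.
have r1 : 1 <= r%:R :> R by rewrite ler1n.
have D0 := D_gt0; have lb := scaled_lb; have /andP[a1 a2] := e1_sq; have /andP[b1 b2] := re2D.
have rD : Dr <= r%:R * Dr by rewrite ler_peMl // ltW.
have E := scaledE; move: lb a1 a2 b1 b2 E rD; rewrite -mulrA.
set s := scaled; set x := (eps1 * Dr) ^+ 2; set y := r%:R * (eps2 * Dr) * Dr; set z := r%:R * Dr.
set u := (e1 * e1)%:R; set v := (r * e2 * D)%:R => lb a1 a2 b1 b2 E rD.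
have vu : (r * e2 * D <= e1 * e1)%N by rewrite -(ler_nat R) -/u -/v; lra.
by rewrite natrB // -/u -/v; apply/andP; split; lra.
Qed.

Lemma d_gt0 : (0 < d)%N.
Proof.
have /andP[H _] := d_bounds; rewrite -(ltr0n R); apply: lt_le_trans H.
have := scaled_lb; have : 0 < r%:R * Dr by rewrite mulr_gt0 ?D_gt0 // ltr0n.
rewrite -mulrA; lra.
Qed.

(* The midpoint of [eps1 ^+ 2 / r] and [eps2], computed from the truncated inputs. *)
Definition threshold : R := (e1 * e1 + r * e2 * D)%:R / (2 * r * (D * D))%:R.

(** Rounding down only lowers the threshold; the total loss 2D + r D <= 3 r D in the numerator is at
    most a quarter of [scaled], which is delta / 8 after division. *)
Lemma threshold_bounds :
  threshold <= (eps1 ^+ 2 / r%:R + eps2) / 2 <= threshold + delta / 8.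
Proof.
have r0' : 0 < r%:R :> R by rewrite ltr0n.
have D0 := D_gt0; have /andP[a1 a2] := e1_sq; have /andP[b1 b2] := re2D.
have lb := scaled_lb; have r1 : 1 <= r%:R :> R by rewrite ler1n.
have rD : Dr <= r%:R * Dr by rewrite ler_peMl // ltW.
have hE : (2 * r * (D * D))%:R = 2 * (r%:R * Dr ^+ 2) :> R by rewrite !natrM; ring.
have h0 : 0 < (2 * r * (D * D))%:R :> R by rewrite hE !mulr_gt0 // exprn_gt0.
have mE : (eps1 ^+ 2 / r%:R + eps2) / 2 = ((eps1 * Dr) ^+ 2 + r%:R * (eps2 * Dr) * Dr) / (2 * r * (D * D))%:R.
  rewrite hE; field; by rewrite ?(lt0r_neq0 D0) ?(lt0r_neq0 r0').
have dE : delta / 8 = (scaled / 4) / (2 * r * (D * D))%:R.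
  rewrite hE; field; by rewrite ?(lt0r_neq0 D0) ?(lt0r_neq0 r0').
rewrite mE dE /threshold -mulrDl !ler_pM2r ?invr_gt0 // natrD.
move: a1 a2 b1 b2 lb rD; rewrite -[12 * _ * _]mulrA.
set x := (eps1 * Dr) ^+ 2; set y := r%:R * (eps2 * Dr) * Dr; set z := r%:R * Dr.
set u := (e1 * e1)%:R; set v := (r * e2 * D)%:R; set s := scaled => *.
by apply/andP; split; lra.
Qed.

Lemma threshold_sq_le1 : threshold ^+ 2 <= 1.
Proof.
have /andP[H _] := threshold_bounds; have /andP[a b] := eps1_01; have /andP[c e] := eps2_01.
have t0 : 0 <= threshold by rewrite divr_ge0 ?ler0n.
rewrite expr_le1 //; apply: le_trans H _.
have : eps1 ^+ 2 / r%:R <= 1.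
  rewrite ler_pdivrMr ?ltr0n // mul1r; apply: (@le_trans _ _ 1); first by rewrite expr_le1.
  by rewrite ler1n.
lra.
Qed.

Lemma mean_case_a (G : R) : eps1 ^+ 2 * P ^+ 2 <= r%:R * G ->
  delta * P ^+ 2 / 4 <= G - threshold * P ^+ 2.
Proof.
move=> H; have r0' : 0 < r%:R :> R by rewrite ltr0n.
have {}H : eps1 ^+ 2 / r%:R * P ^+ 2 <= G by rewrite mulrAC ler_pdivrMr // [leRHS]mulrC.
have /andP[t _] := threshold_bounds; have d0 := delta_gt0.
have : 0 <= P ^+ 2 by rewrite sqr_ge0.
move: H t d0; set x := eps1 ^+ 2 / r%:R; set y := P ^+ 2; nra.
Qed.

(** Half the gap minus the rounding loss of the threshold is at least delta (1/2 - 1/8), more than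
    the delta / 4 required. *)
Lemma mean_case_b (G : R) : G <= eps2 * P ^+ 2 ->
  G - threshold * P ^+ 2 <= - (delta * P ^+ 2 / 4).
Proof.
move=> H; have /andP[_ t] := threshold_bounds; have d0 := delta_gt0.
have : 0 <= P ^+ 2 by rewrite sqr_ge0.
move: H t d0; set x := eps1 ^+ 2 / r%:R; set y := P ^+ 2; nra.
Qed.

Local Notation a := (kap * (p * p) * r * (D * D))%N.
Variable M : nat.
Hypotheses (M_upper : (a <= M * d)%N) (M_lower : (M * d <= a + d)%N).

(** Ensures that rounding the quotient up at most doubles it: M d <= a + d <= 2a. *)
Lemma d_le_a : (d <= a)%N.
Proof.
have : (d <= D * D)%N by apply: leq_trans (leq_subr _ _) _; apply: leq_mul; exact: e1_le_D.
move/leq_trans; apply; rewrite leq_pmull // -(ltr0n R) natrM mulr_gt0 ?ltr0n ?muln_gt0 ?kap0 ?p0 ?r0 //.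
Qed.

Lemma M_delta_lb : kap%:R * p%:R ^+ 2 <= 2 * (M%:R * delta).
Proof.
have r0' : 0 < r%:R :> R by rewrite ltr0n.
have D0 := D_gt0; have d0 := delta_gt0.
have w0 : 0 < r%:R * Dr ^+ 2 by rewrite mulr_gt0 // exprn_gt0.
rewrite -(ler_pM2r w0); apply: (@le_trans _ _ (M%:R * d%:R)).
  move: M_upper; rewrite -(ler_nat R) !natrM; apply: le_trans.
  by rewrite le_eqVlt; apply/orP; left; apply/eqP; ring.
have /andP[_ H] := d_bounds; apply: le_trans (ler_wpM2l (ler0n _ M) H) _.
have -> : 2 * (M%:R * delta) * (r%:R * Dr ^+ 2) = 2 * (M%:R * scaled) by ring.
have : 0 <= M%:R * scaled by rewrite mulr_ge0 ?ler0n // mulr_ge0 ?sqr_ge0 // ltW // mulr_gt0.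
set s := scaled; lra.
Qed.

Lemma M_delta_ub : M%:R * delta <= 3 * (kap%:R * p%:R ^+ 2).
Proof.
have r0' : 0 < r%:R :> R by rewrite ltr0n.
have D0 := D_gt0; have d0 := delta_gt0.
have w0 : 0 < r%:R * Dr ^+ 2 by rewrite mulr_gt0 // exprn_gt0.
rewrite -(ler_pM2r w0).
have -> : M%:R * delta * (r%:R * Dr ^+ 2) = M%:R * scaled by ring.
have /andP[H _] := d_bounds; have := ler_wpM2l (ler0n _ M) H.
have : (M * d <= 2 * a)%N by apply: leq_trans M_lower _; rewrite mul2n -addnn leq_add2l d_le_a.
rewrite -(ler_nat R) natrM.
have -> : (2 * a)%:R = 2 * (kap%:R * p%:R ^+ 2 * (r%:R * Dr ^+ 2)) :> R by rewrite !natrM; ring.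
rewrite -[3 * _ * _]mulrA.
have : 0 <= kap%:R * p%:R ^+ 2 * (r%:R * Dr ^+ 2) by rewrite mulr_ge0 ?mulr_ge0 ?sqr_ge0 ?ler0n // ltW.
set s := scaled; set y := kap%:R * _ * _; set m := M%:R * d%:R.
have -> : M%:R * (5 / 6 * s) = 5 / 6 * (M%:R * s) by ring.
set t := M%:R * s; lra.
Qed.

(** M <= 3 kap p^2 / delta gives 8 M^2 <= 72 (kap p^2 / delta)^2, and the factor r^2 comes from
    writing delta as (eps1^2 - r eps2) / r. *)
Lemma copies_bound :
  (8 * (M * M))%:R <= 72 * kap%:R ^+ 2 * r%:R ^+ 2
    * (p%:R ^+ 2 / (eps1 ^+ 2 - r%:R * eps2)) ^+ 2.
Proof.
have r0' : r%:R != 0 :> R by rewrite pnatr_eq0 -lt0n.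
have d0 := delta_gt0; have H := M_delta_ub.
have -> : eps1 ^+ 2 - r%:R * eps2 = r%:R * delta by field.
have -> : 72 * kap%:R ^+ 2 * r%:R ^+ 2 * (p%:R ^+ 2 / (r%:R * delta)) ^+ 2
   = 8 * (3 * (kap%:R * p%:R ^+ 2) / delta) ^+ 2.
  by have := lt0r_neq0 d0; set t := delta => t0; field; rewrite r0' t0.
rewrite natrM ler_pM2l ?ltr0n // natrM -expr2 ler_pXn2r ?nnegrE ?ler0n //.
  by rewrite ler_pdivlMr.
by rewrite divr_ge0 ?(ltW d0) // !mulr_ge0 ?sqr_ge0 ?ler0n.
Qed.

Lemma M_gt0 : (0 < M)%N.
Proof.
rewrite lt0n; apply: contraTneq M_upper => ->; rewrite mul0n leqn0 -lt0n.
exact: leq_trans d_gt0 d_le_a.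
Qed.

(** The quotient is at most 32 / (M delta P^2)^2. As M delta >= kap p^2 / 2 and p P >= 1, it is at
    most 128 / kap^2. *)
Lemma error_bound (eta : R) : 128 <= kap%:R ^+ 2 * eta ->
  (M * M)%:R * (1 + threshold ^+ 2) / ((M * M)%:R * (delta * P ^+ 2 / 4)) ^+ 2 <= eta.
Proof.
move=> Hk; have d0 := delta_gt0; have P0 := purity_gt0; have t1 := threshold_sq_le1.
have M0 : 0 < M%:R :> R by rewrite ltr0n M_gt0.
have pP : 1 <= p%:R * P by rewrite -ler_pdivrMl ?ltr0n // mulr1.
pose x := M%:R * (delta * P ^+ 2).
have x0 : 0 < x by rewrite !mulr_gt0 // exprn_gt0.
have kx : kap%:R <= 2 * x.
  have -> : 2 * x = 2 * (M%:R * delta) * P ^+ 2 by rewrite /x; ring.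
  apply: le_trans (ler_wpM2r (sqr_ge0 P) M_delta_lb).
  rewrite -mulrA -exprMn ler_peMr ?ler0n // expr_ge1 //.
  exact: le_trans ler01 pP.
have kx2 : kap%:R ^+ 2 <= 4 * x ^+ 2.
  have -> : 4 * x ^+ 2 = (2 * x) ^+ 2 by ring.
  by rewrite ler_pXn2r ?nnegrE ?ler0n // mulr_ge0 // ltW.
have eta0 : 0 <= eta.
  have k0 : 0 < kap%:R ^+ 2 :> R by rewrite exprn_gt0 // ltr0n.
  by rewrite -(pmulr_rge0 _ k0); apply: le_trans Hk.
rewrite natrM -expr2.
have -> : M%:R ^+ 2 * (1 + threshold ^+ 2) / (M%:R ^+ 2 * (delta * P ^+ 2 / 4)) ^+ 2
  = 16 * (1 + threshold ^+ 2) / x ^+ 2.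
  rewrite /x; have := lt0r_neq0 d0; set t := delta => t0; field.
  by rewrite (lt0r_neq0 P0) (lt0r_neq0 M0) t0.
rewrite ler_pdivrMr ?exprn_gt0 //.
have := ler_wpM2l eta0 kx2; move: Hk t1; set y := threshold ^+ 2; set z := x ^+ 2; set k := kap%:R ^+ 2.
nra.
Qed.

End Numeric.

(** * The algorithm *)

Lemma ceil_divn a d (M := ((a + d.-1) %/ d)%N) : (0 < d)%N ->
  [/\ (a <= M * d)%N, forall j, (j < M)%N -> (j * d < a)%N, (M * d <= a + d)%N & (M <= a)%N].
Proof.
move=> d0; have le1 : (M * d <= a + d.-1)%N by apply: leq_trunc_div.
have lt1 : (a + d.-1 < M.+1 * d)%N by apply: ltn_ceil.
have low j : (j < M)%N -> (j * d < a)%N.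
  move=> jM; have : (j.+1 * d <= M * d)%N by rewrite leq_mul2r jM orbT.
  by rewrite mulSn; lia.
split=> //; first by move: lt1; rewrite mulSn; lia.
- by lia.
- case: (M) low => // m low; apply: leq_ltn_trans (low m (ltnSn m)).
  by rewrite leq_pmulr.
Qed.

Section Algorithm.
Variables (kap : nat) (p q : {poly nat}).

Definition algorithm : qalgorithm :=
  QAlgorithm (prep_prog kap p q) decide_prog ((12%N)%:P * q).

Definition numerator_max (n : nat) : nat :=
  (kap * (p.[n] * p.[n]) * q.[n] * (12 * q.[n] * (12 * q.[n])))%N.

(** A sum rather than a maximum: each register bound follows by linear arithmetic, and polynomial
    growth by closure under sums. The input r is replaced by its bound q(n). *)
Definition value_max (n : nat) : nat :=
  (8 + n + q.[n] + 12 * q.[n] + 12 * q.[n] * (12 * q.[n]) + numerator_max n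
   + 8 * (numerator_max n * numerator_max n)
   + 8 * (numerator_max n * numerator_max n) * n)%N.

Definition time_max (n : nat) : nat :=
  (prep_time kap p q (value_max n) + value_max n + decide_time (value_max n))%N.

Lemma poly_bounded_time : poly_bounded time_max.
Proof.
have pbV : poly_bounded value_max.
  rewrite /value_max /numerator_max;
  do ?[exact: poly_bounded_const|exact: poly_bounded_id|exact: poly_bounded_horner
      |apply: poly_bounded_add|apply: poly_bounded_mul].
rewrite /time_max /prep_time /decide_time;
do ?[exact: poly_bounded_const|exact: pbV|exact: poly_bounded_block
    |apply: poly_bounded_add|apply: poly_bounded_mul|apply: poly_bounded_succ].
Qed.

Variables (R : realType) (n : nat) (A : {set 'I_n}) (rho : operator R 'I_n).
Variables (inp : nat -> nat) (r e1 e2 : nat).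
Local Notation D := (12 * q.[n])%N.
Local Notation d := (e1 * e1 - r * e2 * D)%N.
Local Notation a := (kap * (p.[n] * p.[n]) * r * (D * D))%N.
Hypotheses (inp0 : inp 0%N = n) (inp1 : inp 1%N = r) (inp2 : inp 2%N = e1) (inp3 : inp 3%N = e2).
Hypothesis inp_mask : forall i, inp i.+4 = mask_of A i.
Hypotheses (d0 : (0 < d)%N) (rq : (r <= q.[n])%N) (r0 : (0 < r)%N) (q0 : (0 < q.[n])%N)
  (e1D : (e1 <= D)%N) (e2D : (e2 <= D)%N).
Let M := ((a + d.-1) %/ d)%N.
Let N := (M * M)%N.
Let gs := bell_circuit (src n (mask_of A)) (tgt n (mask_of A)) (pair_list n N).
Let stat := @statistic R _ _ (@sign R n N A) (weight (threshold R r e1 e2 D)).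

Lemma algorithm_runs :
  runs algorithm inp rho (time_max n) (8 * N)
    (\sum_(z | 0 <= stat z) prob rho gs z).
Proof.
have [M_up M_low _ Ma] := ceil_divn a d0; rewrite -/M in M_up M_low Ma.
have aV : (a <= numerator_max n)%N by rewrite /numerator_max leq_mul2r leq_mul2l rq !orbT.
have NV : (N <= numerator_max n * numerator_max n)%N.
  by apply: leq_mul; apply: leq_trans Ma aV.
have dD : (d <= D * D)%N by apply: leq_trans (leq_subr _ _) _; apply: leq_mul.
have N8 : (8 * N <= 8 * (numerator_max n * numerator_max n))%N by rewrite leq_mul2l NV.
have N8n : (8 * N * n <= 8 * (numerator_max n * numerator_max n) * n)%N by rewrite leq_mul2r N8 orbT.
have H1 : (8 <= value_max n)%N by rewrite /value_max; lia.
have H2 : (n <= value_max n)%N by rewrite /value_max; lia.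
have H3 : (r <= value_max n)%N by rewrite /value_max; lia.
have H4 : (D <= value_max n)%N by rewrite /value_max; lia.
have H5 : (d <= value_max n)%N by apply: leq_trans dD _; rewrite /value_max; lia.
have H6 : (a <= value_max n)%N by apply: leq_trans aV _; rewrite /value_max; lia.
have H7 : (M <= value_max n)%N := leq_trans Ma H6.
have H8 : (8 * N <= value_max n)%N by apply: leq_trans N8 _; rewrite /value_max; lia.
have H9 : (8 * N * n <= value_max n)%N by apply: leq_trans N8n _; rewrite /value_max; lia.
have He1 := leq_trans e1D H4; have He2 := leq_trans e2D H4.
have im i : (i < n)%N -> inp i.+4 = mask_of A i by [].
have [t1 [s1 [X1 X2 X3]]] := steps_prep inp0 inp1 inp2 inp3 im M_up M_low
  H1 H2 H3 He1 He2 H4 H5 H6 H7 H8 H9 holds_config0.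
have circE : circ s1 = gs by rewrite X3.2 (@sweep_gates_bell n N (mask_of A) (run_params q n r e1 e2 M) erefl).
have dec (z : bits 'I_(8 * N * n + 0)) : exists t2 s2,
    [/\ exec inp (wire z) decide_prog s1 t2 s2, (t2 <= decide_time (value_max n))%N
      & (memory s2 0 != 0%N) = (0 <= stat z)].
  have [gs' [e' [st /= [sz nth0]]]] := steps_decide inp0 inp1 inp2 inp3 im M_up
    H1 H2 H3 He1 He2 H4 H5 H6 H7 H8 H9 (wire z)
    (sweep_gates (run_params q n r e1 e2 M) (mask_of A) pair_gates N).
  have [t2 [s2 [Y1 Y2 [Y3 _]]]] := st _ X3.
  exists t2, s2; split=> //; rewrite Y3 ?sz // nth0 /stat statistic_odd -/N.
  rewrite -/(odd_blocks (mask_of A) n M (wire z) false) -/(odd_blocks (mask_of A) n M (wire z) true).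
  move: (odd_blocks _ _ _ _ false) (odd_blocks _ _ _ _ true) => x y.
  have h0 : 0 < (2 * r * (D * D))%:R :> R by rewrite ltr0n !muln_gt0 r0 q0.
  (* The 1 added in [verdict_ops] makes a nonzero difference mean a non-strict inequality;
     multiplying by 2 r D^2 > 0 clears the denominator of the threshold. *)
  rewrite subn_eq0 -ltnNge addn1 ltnS -(ler_nat R) -subr_ge0 -[RHS](pmulr_rge0 _ h0).
  rewrite /threshold; congr (0 <= _).
  move: h0; move: (2 * r * (D * D))%N (e1 * e1 + r * e2 * D)%N => h g h0.
  rewrite !(natrD, natrM); field; exact: lt0r_neq0.
exists t1, 0%N, s1; split=> //.
- by rewrite X3.1.
- by rewrite X3.1.
- move=> z; have [t2 [s2 [Y1 Y2 _]]] := dec z; exists t2, s2; split=> //.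
  rewrite addn0 /time_max; apply: leq_add => //; exact: leq_add.
- rewrite circE; apply: eq_bigl => z; have [t2 [s2 [Y1 _ <-]]] := dec z.
  apply/idP/asboolP => [nz|[t [s [E nz]]]]; first by exists t2, s2.
  by have [_ <-] := exec_det E Y1.
Qed.

End Algorithm.

Theorem theorem3 (R : realType) (eta : R) (eta_gt0 : 0 < eta) :
  exists C : R, forall p q : {poly nat},
    (forall n : nat, 0 < p.[n])%N -> (forall n : nat, 0 < q.[n])%N ->
  exists (alg : qalgorithm) (T : {poly nat}),
    forall (n : nat) (A : {set 'I_n}) (r : nat) (eps1 eps2 : R)
           (rho : operator R 'I_n),
      (1 <= r)%N ->
      0 <= eps1 <= 1 -> 0 <= eps2 <= 1 ->
      is_state rho ->
      (p.[n])%:R^-1 <= purity rho ->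
      (q.[n])%:R^-1 < (eps1 ^+ 2 / r%:R - eps2) * purity rho ^+ 2 ->
    exists (k : nat) (P : R),
      [/\ runs alg (instance (precision alg).[n] A r eps1 eps2) rho T.[n] k P,
          k%:R <= C * r%:R ^+ 2
                  * ((p.[n])%:R ^+ 2 / (eps1 ^+ 2 - r%:R * eps2)) ^+ 2,
          eps1 <= max_overlap A r rho -> 1 - eta <= P
        & max_overlap A r rho <= eps2 -> P <= eta].
Proof.
(* [kap] depends on [eta] only, so the constant 72 kap^2 can be fixed before [p] and [q]. *)
pose kap := (Num.truncn (128 / eta)).+1.
have kapP : 128 <= kap%:R ^+ 2 * eta.
  rewrite -ler_pdivrMr //; apply: (@le_trans _ _ kap%:R).
    by rewrite ltW // truncnS_gt.
  by rewrite ler_eXnr // ler1n.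
exists (72 * kap%:R ^+ 2) => p q p0 q0.
have [T TP] := poly_bounded_time kap p q.
exists (algorithm kap p q), T => n A r eps1 eps2 rho r0 eps1_01 eps2_01 st Pp gap.
have DE : (precision (algorithm kap p q)).[n] = (12 * q.[n])%N by rewrite /= hornerCM.
rewrite DE; set D := (12 * q.[n])%N.
pose e1 := Num.truncn (eps1 * D%:R); pose e2 := Num.truncn (eps2 * D%:R).
have e1P : e1%:R <= eps1 * D%:R < e1.+1%:R.
  by apply: truncn_itv; case/andP: eps1_01 => ? _; rewrite mulr_ge0 ?ler0n.
have e2P : e2%:R <= eps2 * D%:R < e2.+1%:R.
  by apply: truncn_itv; case/andP: eps2_01 => ? _; rewrite mulr_ge0 ?ler0n.
have P1 : purity rho <= 1 := purity_le1 st.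
have P0 : 0 < purity rho := purity_gt0 (p0 n) Pp.
have rhoH : rho \is hermsymmx by case: st.
have d0 : (0 < e1 * e1 - r * e2 * D)%N.
  by apply: (@d_gt0 R (purity rho) eps1 eps2 p.[n] q.[n]).
have rq : (r <= q.[n])%N := rank_le_q (p0 n) (q0 n) r0 eps1_01 eps2_01 Pp P1 gap.
have e1D : (e1 <= D)%N := e1_le_D eps1_01 e1P.
have e2D : (e2 <= D)%N := e2_le_D eps2_01 e2P.
set a := (kap * (p.[n] * p.[n]) * r * (D * D))%N.
set d := (e1 * e1 - r * e2 * D)%N in d0.
pose M := ((a + d.-1) %/ d)%N; pose N := (M * M)%N.
have [M_up _ M_low _] := ceil_divn a d0; rewrite -/M in M_up M_low.
have M0 : (0 < M)%N.
  exact: (M_gt0 (kap := kap) (erefl D) (p0 n) (q0 n) r0 isT eps1_01 Pp P1 gap e1P e2P M_up).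
have inp_mask i : instance D A r eps1 eps2 i.+4 = mask_of A i.
  by rewrite /= /mask_of; case: insub.
have run := @algorithm_runs kap p q R n A rho (instance D A r eps1 eps2) r e1 e2
  erefl erefl erefl erefl inp_mask d0 rq r0 (q0 n) e1D e2D.
rewrite -/D -/a -/d -/M -/N in run.
set gs := bell_circuit _ _ _ in run; set c := threshold R r e1 e2 D in run.
set stat := statistic _ _ in run.
set t := N%:R * ((eps1 ^+ 2 / r%:R - eps2) * purity rho ^+ 2 / 4).
have t0 : 0 < t.
  rewrite mulr_gt0 ?ltr0n ?muln_gt0 ?M0 // divr_gt0 // mulr_gt0 ?exprn_gt0 //.
  exact: (delta_gt0 (p0 n) (q0 n) Pp gap).
(* Both error events have this form: the mean lies at distance at least [t] from 0 on the correct
   side, so a wrong sign of [stat] is a deviation of at least [t]. *)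
have cheb (B : pred (bits 'I_(8 * N * n + 0))) :
    (forall z, B z -> t <= `|stat z - statistic_mean (@sign_mean R n N A rho) (@weight R N c)|) ->
    \sum_(z | B z) prob rho gs z <= eta.
  move=> Bt; apply: le_trans (_ : (N%:R * (1 + c ^+ 2)) / t ^+ 2 <= _).
    rewrite -[X in _ <= X / _](weight_norm N c).
    apply: (@chebyshev _ _ _ (prob rho gs) (@sign R n N A) (sign_mean A rho)) => //.
    - exact: prob_ge0.
    - exact: prob_sum1.
    - exact: prob_sign.
    - exact: prob_sign2.
    - exact: sign_sq.
  exact: (error_bound (kap := kap) (erefl D) (p0 n) (q0 n) r0 isT eps1_01 eps2_01 Pp P1 gap e1P e2P M_up kapP).
exists (8 * N)%N, (\sum_(z | 0 <= stat z) prob rho gs z); split.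
- case: run => t1 [b [s1 [X1 X2 X3 X4 X5]]]; exists t1, b, s1; split=> // z.
  have [t2 [s2 [Y1 Y2]]] := X4 z; exists t2, s2; split=> //.
  exact: leq_trans Y2 (TP n).
- exact: (copies_bound (kap := kap) (erefl D) (p0 n) (q0 n) r0 isT eps1_01 Pp P1 gap e1P e2P M_low).
- move=> ov; have /andP[eps1_ge0 _] := eps1_01.
  have := mean_case_a (erefl D) (p0 n) (q0 n) r0 eps1_01 Pp P1 gap e1P e2P
    (overlap_ge_gram rhoH P0 eps1_ge0 ov).
  move/(ler_wpM2l (ler0n R N)); rewrite -weight_mean -/t -/c => mean_ge.
  rewrite lerBlDl -(prob_sum1 st (erefl gs)) (bigID (fun z => 0 <= stat z)) /= addrC lerD2r.
  apply: cheb => z; rewrite -ltNge => sz.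
  by rewrite distrC ger0_norm; lra.
- move=> ov; have /andP[eps2_ge0 _] := eps2_01.
  have := mean_case_b (erefl D) (p0 n) (q0 n) r0 eps1_01 Pp P1 gap e1P e2P
    (overlap_le_gram rhoH P0 r0 eps2_ge0 ov).
  move/(ler_wpM2l (ler0n R N)); rewrite -weight_mean mulrN -/t -/c => mean_le.
  apply: cheb => z sz.
  by rewrite ger0_norm; lra.
Qed.
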